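(* Let $d>1$ and let $q=(q_1,\dots,q_d)$ be a vector of positive integers. Suppose that the moving average polynomial $\theta(x)=\sum_{k\in[0,q]}a_kx^k$ is generic, and let $\gamma=\Gamma_q(a)\in\mathcal{MA}_q$ be the point it generates. Then the fiber $\Gamma_q^{-1}(\gamma)$ consists of only two points $a$ and $a'$ in $\mathbb{P}^Q$, and one is obtained from the other by $a'_k=a_{q-k}$ for every $k\in[0,q]$.
   Context: Work over $\mathbb{C}$. For $u,v\in\mathbb{Z}^d$ write $[u,v]=\{s\in\mathbb{Z}^d: u_i\le s_i\le v_i,\ 1\le i\le d\}$, let $\succeq$ be the lexicographic order on $\mathbb{Z}^d$, and $x^k=x_1^{k_1}\cdots x_d^{k_d}$. Put $Q=\prod_{i=1}^d(q_i+1)-1$ and $N=\bigl(\prod_{i=1}^d(2q_i+1)-1\bigr)/2$. For $a=(a_k)_{k\in[0,q]}\in\mathbb{C}^{Q+1}$ and $t\in[-q,q]$ let $\gamma_a(t)=\sum_{k,\,k+t\in[0,q]}a_ka_{k+t}$; one has $\gamma_a(-t)=\gamma_a(t)$. The autocovariance map is $\Gamma_q:\mathbb{P}^Q\to\mathbb{P}^N$, $a\mapsto(\gamma_a(t))_{t\in[-q,q],\,t\succeq0}$ (it is defined everywhere), and the autocovariance variety $\mathcal{MA}_q$ is its image. ''Generic'' means: the statement holds for almost all coefficient vectors $a\in\mathbb{C}^{Q+1}$ with respect to Lebesgue measure. *)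

(* Defs.v *)
From HB Require Import structures.
From mathcomp Require Import all_boot all_order all_algebra.
From mathcomp Require Import generic_quotient complex.
From mathcomp Require Import all_classical all_reals all_analysis.

Set Implicit Arguments.
Unset Strict Implicit.
Unset Printing Implicit Defensive.

Import Order.TTheory GRing.Theory Num.Theory.

Local Open Scope quotient_scope.
Local Open Scope classical_set_scope.
Local Open Scope ring_scope.

Notation Zvec d := {ffun 'I_d -> int}.

Definition in_box d (u v : Zvec d) : pred (Zvec d) :=
  fun s => [forall i, u i <= s i <= v i].

Definition box d (u v : Zvec d) : Type := {s : Zvec d | in_box u v s}.

Section BoxFinite.
Context (d : nat) (u v : Zvec d).

HB.instance Definition _ := SubCountable.on (box u v).

Let width : nat := \sum_i `|v i - u i|%N.

Let box_code (s : box u v) : {ffun 'I_d -> 'I_width.+1} :=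
  [ffun i => inord `|val s i - u i|%N].

Let box_decode (f : {ffun 'I_d -> 'I_width.+1}) : option (box u v) :=
  insub [ffun i => u i + (f i)%:Z].

Let box_codeK : pcancel box_code box_decode.
Proof.
move=> s; rewrite /box_decode; set w := (X in insub X).
suff -> : w = val s by rewrite valK.
apply/ffunP => i; rewrite !ffunE.
have /andP[us sv] : u i <= val s i <= v i by exact: (forallP (valP s)).
have us0 : 0 <= val s i - u i by rewrite subr_ge0.
rewrite inordK; first by rewrite gez0_abs // subrKC.
rewrite ltnS /width (bigD1 i) //=; apply: leq_trans (leq_addr _ _).
rewrite -lez_nat !gez0_abs ?lerD2r //.
by rewrite subr_ge0 (le_trans us sv).
Qed.

HB.instance Definition _ := fintype.isFinite.Build (box u v) (pcan_enumP box_codeK).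

End BoxFinite.

Definition lexvec d (s : Zvec d) : d.-tuplelexi int := [tuple s i | i < d].

Definition lex_le d (s t : Zvec d) : bool := (lexvec s <= lexvec t)%O.

Lemma lexvec_inj d : injective (@lexvec d).
Proof.
move=> s t st; apply/ffunP => i.
by have := congr1 (fun w : d.-tuple int => tnth w i) st; rewrite !tnth_mktuple.
Qed.

Lemma lex_le_add d (s t u : Zvec d) : lex_le (s + u) (t + u) = lex_le s t.
Proof.
pose lexseq (r : Zvec d) (l : seq 'I_d) : seqlexi int := map r l.
have le_map l :
    (lexseq (s + u) l <= lexseq (t + u) l)%O = (lexseq s l <= lexseq t l)%O.
  elim: l => [|i l IH] //=.
  by rewrite !Order.SeqLexiOrder.lexi_cons !ffunE !lerD2r IH.
exact: le_map.
Qed.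

Definition lag d (q : Zvec d) : Type :=
  {t : box (- q) q | lex_le 0 (val t)}.

HB.instance Definition _ d (q : Zvec d) := SubCountable.on (lag q).
HB.instance Definition _ d (q : Zvec d) := [Finite of lag q by <:].

Lemma in_box_rev d (q k : Zvec d) : in_box 0 q k -> in_box 0 q (q - k).
Proof.
move=> /forallP k_q; apply/forallP => i; have := k_q i; rewrite !ffunE.
by rewrite subr_ge0 gerDl oppr_le0 andbC.
Qed.

Definition box_rev d (q : Zvec d) (k : box 0 q) : box 0 q :=
  exist _ (q - val k) (in_box_rev (valP k)).

Section Projective.
Context (K : fieldType) (I : finType).

Definition nonzero : Type := {a : {ffun I -> K} | a != 0}.
HB.instance Definition _ := SubChoice.on nonzero.

Definition proportional (a b : nonzero) : bool :=
  `[< exists2 c : K, c != 0 & forall i, val b i = c * val a i >].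

Lemma proportional_equiv : equiv_class_of proportional.
Proof.
split=> [a|a b|b a c].
- by apply/asboolP; exists 1; [exact: oner_neq0|move=> i; rewrite mul1r].
- apply/asboolP/asboolP => -[c c0 ab]; exists c^-1; rewrite ?invr_eq0 // => i;
    by rewrite ab mulKf.
- move=> /asboolP[x x0 ab] /asboolP[y y0 bc]; apply/asboolP; exists (y * x).
    by rewrite mulf_neq0.
  by move=> i; rewrite bc ab mulrA.
Qed.

Canonical proportional_equiv_rel := EquivRelPack proportional_equiv.

Definition proj_space : Type := {eq_quot proportional}.
HB.instance Definition _ := Choice.on proj_space.
HB.instance Definition _ := Quotient.on proj_space.

Definition proj_pt (a : nonzero) : proj_space := \pi_{eq_quot proportional} a.

Lemma proj_eqP (a b : nonzero) : reflect (proj_pt a = proj_pt b) (proportional a b).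
Proof. exact: (@eqmodP _ proportional_equiv_rel). Qed.

End Projective.

Section Autocovariance.
Context (K : fieldType) (d : nat) (q : Zvec d).

(** The pairs [p] run over [(k, k + t)] with both entries in [[0, q]]. *)
Definition autocov (a : {ffun box 0 q -> K}) (t : Zvec d) : K :=
  \sum_(p : box 0 q * box 0 q | val p.2 == val p.1 + t) a p.1 * a p.2.

Definition autocov_vec (a : {ffun box 0 q -> K}) : {ffun lag q -> K} :=
  [ffun t => autocov a (val (val t))].

Definition reverse (a : {ffun box 0 q -> K}) : {ffun box 0 q -> K} :=
  [ffun k => a (box_rev k)].

(** This is why the autocovariance map has no base points. *)
Lemma autocov_vec_neq0 (a : nonzero K (box 0 q)) : autocov_vec (val a) != 0.
Proof.
case: a => a /= a0.
have [k ak] : exists k, a k != 0.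
  have [//|none] := pselect (exists k, a k != 0).
  case/negP: a0; apply/eqP/ffunP => k; rewrite ffunE; apply/eqP/contraT => ak.
  by case: none; exists k.
pose P := [pred l | a l != 0].
case: (@Order.TotalTheory.arg_minP _ _ _ k P (fun l => lexvec (val l)) ak) => k0 ak0 mink0.
case: (@Order.TotalTheory.arg_maxP _ _ _ k P (fun l => lexvec (val l)) ak) => k1 ak1 maxk1.
have tb : in_box (- q) q (val k1 - val k0).
  apply/forallP => i; rewrite !ffunE.
  have := forallP (valP k0) i; have := forallP (valP k1) i; rewrite !ffunE.
  move=> /andP[k10 k1q] /andP[k00 k0q]; rewrite -[- q i]sub0r lerB //=.
  by rewrite -[leRHS]subr0 lerB.
pose t : box (- q) q := Sub (val k1 - val k0) tb.
have tl : lex_le 0 (val t).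
  by rewrite -(lex_le_add _ _ (val k0)) add0r /= subrK; exact: mink0.
apply/eqP => /ffunP/(_ (Sub t tl)).
rewrite !ffunE /autocov /= (bigD1 (k0, k1)) /=; last by rewrite subrKC.
rewrite big1 ?addr0; first by apply/eqP; rewrite mulf_neq0.
move=> [l0 l1] /= /andP[/eqP l01 lk].
apply/eqP/contraT; rewrite mulf_eq0 negb_or => /andP[al0 al1].
have l0k0 : l0 = k0.
  apply/val_inj/lexvec_inj/le_anti; rewrite (mink0 l0 al0) andbT.
  rewrite -[(_ <= _)%O]/(lex_le _ _) -(lex_le_add _ _ (val k1 - val k0)) -l01.
  by rewrite subrKC; exact: maxk1.
move: lk; rewrite l0k0 (_ : l1 = k1) ?eqxx //.
by apply/val_inj; rewrite [LHS]l01 l0k0 subrKC.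
Qed.

Lemma box_revK : involutive (@box_rev d q).
Proof. by move=> k; apply/val_inj; rewrite /= subKr. Qed.

Lemma reverse_neq0 (a : nonzero K (box 0 q)) : reverse (val a) != 0.
Proof.
apply: contra (valP a) => /eqP/ffunP ra0; apply/eqP/ffunP => k.
by have := ra0 (box_rev k); rewrite !ffunE box_revK.
Qed.

Definition autocov_nz (a : nonzero K (box 0 q)) : nonzero K (lag q) :=
  exist _ (autocov_vec (val a)) (autocov_vec_neq0 a).

Definition reverse_nz (a : nonzero K (box 0 q)) : nonzero K (box 0 q) :=
  exist _ (reverse (val a)) (reverse_neq0 a).

(** By [Gamma_pt] the choice of the representative of [x] is immaterial. *)
Definition Gamma (x : proj_space K (box 0 q)) : proj_space K (lag q) :=
  proj_pt (autocov_nz (repr x)).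

Lemma Gamma_pt (a : nonzero K (box 0 q)) :
  Gamma (proj_pt a) = proj_pt (autocov_nz a).
Proof.
apply/esym/proj_eqP.
have /esym/proj_eqP/asboolP[c c0 rc] := reprK (proj_pt a).
apply/asboolP; exists (c * c) => [|t]; first by rewrite mulf_neq0.
rewrite /= !ffunE /autocov mulr_sumr; apply: eq_bigr => p _.
by rewrite !rc mulrACA.
Qed.

End Autocovariance.

Section SigmaFiniteProduct.
Local Open Scope ereal_scope.
Context d1 d2 (T1 : measurableType d1) (T2 : measurableType d2) (R : realType).
Variable m1 : {sigma_finite_measure set T1 -> \bar R}.
Variable m2 : {sigma_finite_measure set T2 -> \bar R}.

(** A copy of the library product, because the sigma-finite structure of
    [m1 \x m2] is shadowed there by the one for subprobabilities. *)
Definition sf_prod : set (T1 * T2) -> \bar R := m1 \x m2.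

HB.instance Definition _ := Measure.on sf_prod.

Let sf_prod_sigma_finite : sigma_finite setT sf_prod.
Proof.
have /sigma_finiteP[F [TF ndF Foo]] := sigma_finiteT m1.
have /sigma_finiteP[G [TG ndG Goo]] := sigma_finiteT m2.
exists (fun n => F n `*` G n).
  rewrite -setXTT TF TG predeqE => -[x y]; split.
    move=> [/= [n _ Fnx] [k _ Gky]]; exists (maxn n k) => //; split.
    - by move: x Fnx; exact/subsetPset/ndF/leq_maxl.
    - by move: y Gky; exact/subsetPset/ndG/leq_maxr.
  by move=> [n _ []/= ? ?]; split; exists n.
move=> k; have [? ?] := Foo k; have [? ?] := Goo k.
split; first exact: measurableX.
by rewrite /sf_prod product_measure1E// lte_mul_pinfty// ge0_fin_numE.
Qed.

HB.instance Definition _ := Measure_isSigmaFinite.Build _ _ _ sf_prod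
  sf_prod_sigma_finite.

End SigmaFiniteProduct.

Section PowerMeasure.
Local Open Scope ereal_scope.
Context (dT : measure_display) (T : measurableType dT) (R : realType).

Definition tuple_of_pair n (p : T * n.-tuple T) : n.+1.-tuple T :=
  [tuple of p.1 :: p.2].

Lemma measurable_tuple_of_pair n : measurable_fun setT (@tuple_of_pair n).
Proof. exact: measurable_cons. Qed.

Section Step.
Variables (m : {sigma_finite_measure set T -> \bar R}) (n : nat).
Variable mn : {sigma_finite_measure set (n.-tuple T) -> \bar R}.

Definition prod_cons : set (n.+1.-tuple T) -> \bar R :=
  pushforward (sf_prod m mn) (@tuple_of_pair n).

Let prod_cons0 : prod_cons set0 = 0.
Proof. by rewrite /prod_cons /pushforward preimage_set0 measure0. Qed.

Let prod_cons_ge0 A : 0 <= prod_cons A.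
Proof. by apply: integral_ge0 => x _; exact: measure_ge0. Qed.

Let measurable_preimage_cons A :
  measurable A -> measurable (@tuple_of_pair n @^-1` A).
Proof.
by move=> mA; rewrite -[X in measurable X]setTI; exact: measurable_tuple_of_pair.
Qed.

Let prod_cons_sigma_additive : semi_sigma_additive prod_cons.
Proof.
move=> F mF tF mUF; rewrite /prod_cons /pushforward preimage_bigcup.
apply: measure_semi_sigma_additive.
- by move=> k; exact: measurable_preimage_cons.
- apply/trivIsetP => /= i j _ _ ij; rewrite -preimage_setI.
  by move/trivIsetP : tF => /(_ _ _ _ _ ij) ->//; rewrite preimage_set0.
- by rewrite -preimage_bigcup; exact: measurable_preimage_cons.
Qed.

HB.instance Definition _ := isMeasure.Build _ _ _ prod_cons
  prod_cons0 prod_cons_ge0 prod_cons_sigma_additive.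

Let prod_cons_sigma_finite : sigma_finite setT prod_cons.
Proof.
have [F FT mF] := sigma_finiteT (sf_prod m mn).
pose g (v : n.+1.-tuple T) : T * n.-tuple T := (thead v, [tuple of behead v]).
have gK : cancel (@tuple_of_pair n) g.
  by case=> x t; rewrite /g /tuple_of_pair theadE; congr (_, _); apply/val_inj.
have mg : measurable_fun setT g.
  apply/measurable_fun_pairP; split; last exact: measurable_behead.
  exact: (measurable_tnth ord0).
exists (fun k => g @^-1` F k); first by rewrite -preimage_bigcup -FT preimage_setT.
move=> k; have [mFk Fk] := mF k; split.
  by rewrite -[X in measurable X]setTI; exact: mg.
rewrite /prod_cons /pushforward -comp_preimage.
by rewrite (_ : g \o _ = id) //; apply/funext => p /=; rewrite gK.
Qed.

HB.instance Definition _ := Measure_isSigmaFinite.Build _ _ _ prod_cons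
  prod_cons_sigma_finite.

End Step.

Fixpoint power_measure (m : {sigma_finite_measure set T -> \bar R}) (n : nat) :
    {sigma_finite_measure set (n.-tuple T) -> \bar R} :=
  if n is n'.+1 then prod_cons m (power_measure m n') else \d_[tuple].

End PowerMeasure.

Section LebesgueComplex.
Context (R : realType) (I : finType).

Definition lebesgue_plane :=
  sf_prod (@lebesgue_measure R) (@lebesgue_measure R).

(** [C^I] is identified with [(R^2)^#|I|] through an enumeration of [I]; since
    Lebesgue measure is invariant under permutation of the coordinates, the
    null sets do not depend on the enumeration. *)
Definition coefs (v : #|I|.-tuple (measurableTypeR R * measurableTypeR R)) :
    {ffun I -> R[i]} :=
  [ffun k => let z := tnth v (enum_rank k) in Complex z.1 z.2].

Definition almost_all (P : {ffun I -> R[i]} -> Prop) : Prop :=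
  {ae power_measure lebesgue_plane #|I|, forall v, P (coefs v)}.

End LebesgueComplex.

(* Main.v *)
Require Import Defs.
From mathcomp Require Import all_boot all_order all_algebra complex.
From mathcomp Require Import all_field.
From mathcomp Require Import all_classical all_reals all_analysis measurable_realfun.
From mathcomp Require Import ring lra zify.

Import Order.TTheory GRing.Theory Num.Theory.
Import numFieldNormedType.Exports.
Local Open Scope classical_set_scope.
Local Open Scope ring_scope.

(** Attach to a coefficient vector [a] the polynomial theta_a, the sum of the
    a_k x^k, and its reversal x^q theta_a(1/x), which is the polynomial of
    [reverse a].  The autocovariances of [a] are the coefficients of the product
    of the two, so reversing [a] or changing its sign does not alter them.  If
    theta_a is irreducible, unique factorization shows that nothing else has the
    same autocovariances, and a generic polynomial in at least two variables is
    irreducible.  The proof follows this idea at a single polynomial, where one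
    variable suffices for the factorizations, and reaches generic ones by
    deformation.

    Call [a] good if it is [asymmetric] (not its own reversal up to sign) and
    [determined] (only [a], [- a] and their reversals have its
    autocovariances).  The argument has three ingredients.

    Goodness is a zero-one property.  It is a first-order statement about the
    coordinates of [a] over an algebraically closed field.  Eliminating the
    quantifiers turns it into a Boolean combination of polynomial equations,
    hence there is a nonzero polynomial P such that either all points outside
    the zeros of P are good, or none is ([definable_generic]).  The zeros of P
    are a Lebesgue null set, by Fubini ([zeros_null]).

    One point is understood.  Write x for the first variable, m = q_1, and y^alpha
    for the product of the x_i^(q_i) over the other variables.  The polynomial
    (x^m - 2) + (2 x^m + 1) y^alpha, called [special], is determined
    ([special_fiber]), and the differential of the autocovariance map is
    injective there ([special_rigid]).  Expanding in y reduces both facts to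
    coprimality of polynomials in x; the key input is that the product
    1 - 4 x^(2m) of the lowest coefficient, reversed, and the highest one has
    no multiple root.

    Badness would spread to the special point.  If all points outside the
    zeros of P were bad, there would be bad points a_n converging to
    [special], each with a vector b_n outside the four trivial choices but
    with the same autocovariances.  Pass to limits along an ultrafilter.  After
    rescaling, b_n converges to a nonzero multiple of a trivial choice for
    [special]; after a reversal and a change of sign, to a multiple of [special]
    itself.  Since the autocovariance map is quadratic, the limit of the
    normalized differences b_n - a_n is a nonzero vector killed by its
    differential at [special], a contradiction ([determined_limit]).

    Finally proportional autocovariances become equal ones after rescaling by
    a square root, which gives the projective statement
    ([determined_fiber]). *)

(** * Polynomials in finitely many variables *)

Section IteratedPolynomials.
Context (F : idomainType).

(** Iterating the univariate construction makes the first variable the outermost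
    one, so that inductions on the number of variables meet a univariate
    polynomial over an integral domain. *)
Fixpoint ipoly n : idomainType :=
  if n is m.+1 then ({poly ipoly m} : idomainType) else F.

Fixpoint iconst n : F -> ipoly n :=
  if n is m.+1 then fun c => (iconst m c)%:P else id.

Fixpoint ieval n (e : seq F) : ipoly n -> F :=
  if n is m.+1 then fun p : {poly ipoly m} =>
    ieval m (behead e) p.[iconst m (head 0 e)] else id.

Lemma ievalD n e (p r : ipoly n) : ieval n e (p + r) = ieval n e p + ieval n e r.
Proof. by elim: n e p r => //= n IH e p r; rewrite hornerD IH. Qed.

Lemma ievalM n e (p r : ipoly n) : ieval n e (p * r) = ieval n e p * ieval n e r.
Proof. by elim: n e p r => //= n IH e p r; rewrite hornerM IH. Qed.

Lemma ieval_const n e c : ieval n e (iconst n c) = c.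
Proof. by elim: n e => //= n IH e; rewrite hornerC IH. Qed.

Lemma iconst0 n : iconst n 0 = 0.
Proof. by elim: n => //= n ->. Qed.

Lemma iconst1 n : iconst n 1 = 1.
Proof. by elim: n => //= n ->. Qed.

Lemma iconstN1 n : iconst n (-1) = -1.
Proof. by elim: n => //= n ->; rewrite polyCN. Qed.

Lemma iconst_inj n : injective (iconst n).
Proof. by elim: n => //= n IH c1 c2 /polyC_inj /IH. Qed.

Lemma ieval0 n e : ieval n e 0 = 0.
Proof. by rewrite -(iconst0 n) ieval_const. Qed.

Lemma ieval1 n e : ieval n e 1 = 1.
Proof. by rewrite -(iconst1 n) ieval_const. Qed.

Lemma ievalX n e (p : ipoly n) k : ieval n e (p ^+ k) = ieval n e p ^+ k.
Proof. by elim: k => [|k IH]; rewrite ?expr0 ?ieval1// !exprS ievalM IH. Qed.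

Lemma ieval_cons n x e (p : {poly ipoly n}) :
  ieval n.+1 (x :: e) p = \sum_(i < size p) ieval n e p`_i * x ^+ i.
Proof.
rewrite /= horner_coef (big_morph _ (ievalD n e) (ieval0 n e)).
by apply: eq_bigr => i _; rewrite ievalM ievalX ieval_const.
Qed.

Lemma ieval_var n i : exists p : ipoly n, forall e, size e = n -> ieval n e p = e`_i.
Proof.
elim: n i => [|n IH] i; first by exists 0 => e /size0nil ->; rewrite nth_nil.
case: i => [|i].
  exists ('X : {poly ipoly n}) => e se /=.
  by rewrite hornerX ieval_const nth0.
have [p pE] := IH i; exists (p%:P : {poly ipoly n}) => e se /=.
by rewrite hornerC pE ?nth_behead // size_behead se.
Qed.

Lemma nonroot_of_uniq n (p : {poly ipoly n}) (s : seq F) :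
  p != 0 -> uniq s -> (size p <= size s)%N ->
  exists2 x, x \in s & p.[iconst n x] != 0.
Proof.
move=> p0 us ps.
have [/allP h|/allPn[x xs hx]] := boolP (all (fun x => root p (iconst n x)) s).
  have := @max_poly_roots _ p (map (iconst n) s) p0.
  rewrite map_inj_uniq ?us; last exact: iconst_inj.
  rewrite size_map [(size s < _)%N]ltnNge ps all_map => H.
  by have /(_ isT) := H (introT allP h).
by exists x.
Qed.

(** Choose the coordinates one at a time: each choice has to avoid only the
    finitely many roots of a nonzero univariate polynomial, so that any infinite
    set of candidates will do. *)
Lemma nonroot_box n (p : ipoly n) (S : nat -> F -> Prop) :
  (forall i k, exists s : seq F, [/\ uniq s, size s = k & forall x, x \in s -> S i x]) ->
  p != 0 ->
  exists e, [/\ size e = n, ieval n e p != 0 & forall i, (i < n)%N -> S i e`_i].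
Proof.
elim: n p S => [|n IH] p S hS p0; first by exists [::].
have [s [us ss hs]] := hS 0%N (size (p : {poly ipoly n})).
have [|x xs px] := @nonroot_of_uniq n p s p0 us; first by rewrite ss.
have [e [se he eS]] := IH _ (fun i => S i.+1) (fun i => hS i.+1) px.
by exists (x :: e); split=> [|//|[|i]] /=; [rewrite se|move=> _; exact: hs|exact: eS].
Qed.

End IteratedPolynomials.

Arguments ieval {F} n e p.
Arguments iconst {F} n c.

(** * Definable sets of tuples *)

Section Definable.
Context (F : closedFieldType).
Local Notation ipoly := (ipoly F).

Lemma rterm_ipoly n (t : GRing.term F) : GRing.rterm t ->
  exists p : ipoly n, forall e, size e = n -> ieval n e p = GRing.eval e t.
Proof.
elim: t => //=.
- by move=> i _; exact: ieval_var.
- by move=> c _; exists (iconst n c) => e _; rewrite ieval_const.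
- by move=> k _; exists (iconst n k%:R) => e _; rewrite ieval_const.
- move=> t1 IH1 t2 IH2 /andP[/IH1[p1 h1] /IH2[p2 h2]]; exists (p1 + p2) => e se.
  by rewrite ievalD h1 ?h2.
- move=> t1 IH1 /IH1[p1 h1]; exists (iconst n (-1) * p1) => e se.
  by rewrite ievalM ieval_const mulN1r h1.
- move=> t1 IH1 k /IH1[p1 h1]; exists (iconst n k%:R * p1) => e se.
  by rewrite ievalM ieval_const mulr_natl h1.
- move=> t1 IH1 t2 IH2 /andP[/IH1[p1 h1] /IH2[p2 h2]]; exists (p1 * p2) => e se.
  by rewrite ievalM h1 ?h2.
- move=> t1 IH1 k /IH1[p1 h1]; exists (p1 ^+ k) => e se.
  by rewrite ievalX h1.
Qed.

(** Off the zeros of the differences of the two sides of its nontrivial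
    equations, every atom, hence every Boolean combination, has a constant truth
    value. *)
Lemma qf_generic n (f : GRing.formula F) : GRing.qf_form f -> GRing.rformula f ->
  exists (p : ipoly n) (b : bool), p != 0 /\
    forall e, size e = n -> ieval n e p != 0 -> GRing.qf_eval e f = b.
Proof.
pose generic g := exists (p : ipoly n) (b : bool), p != 0 /\
  forall e, size e = n -> ieval n e p != 0 -> GRing.qf_eval e g = b.
have comb (f1 f2 : GRing.formula F) (op : bool -> bool -> bool) (g : GRing.formula F) :
    (forall e, GRing.qf_eval e g = op (GRing.qf_eval e f1) (GRing.qf_eval e f2)) ->
    generic f1 -> generic f2 -> generic g.
  move=> gE [p1 [b1 [p10 h1]]] [p2 [b2 [p20 h2]]].
  exists (p1 * p2), (op b1 b2); split; first by rewrite mulf_neq0.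
  move=> e se; rewrite ievalM mulf_eq0 negb_or => /andP[e1 e2].
  by rewrite gE h1 ?h2.
elim: f => //=.
- by move=> b _ _; exists 1, b; split=> //; exact: oner_neq0.
- move=> t1 t2 _ /andP[/(rterm_ipoly n)[p1 h1] /(rterm_ipoly n)[p2 h2]].
  have [e12|ne12] := eqVneq p1 p2.
    exists 1, true; split; first exact: oner_neq0.
    by move=> e se _; rewrite -h1 // -h2 // e12 eqxx.
  exists (p1 + iconst n (-1) * p2), false; split.
    apply: contra ne12; rewrite addr_eq0 => /eqP ->.
    by rewrite iconstN1 mulN1r opprK.
  move=> e se; rewrite ievalD ievalM ieval_const mulN1r h1 // h2 // subr_eq0.
  exact: negbTE.
- move=> f1 IH1 f2 IH2 /andP[q1 q2] /andP[r1 r2].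
  exact: (comb f1 f2 andb (GRing.And f1 f2) (fun=> erefl) (IH1 q1 r1) (IH2 q2 r2)).
- move=> f1 IH1 f2 IH2 /andP[q1 q2] /andP[r1 r2].
  exact: (comb f1 f2 orb (GRing.Or f1 f2) (fun=> erefl) (IH1 q1 r1) (IH2 q2 r2)).
- move=> f1 IH1 f2 IH2 /andP[q1 q2] /andP[r1 r2].
  exact: (comb f1 f2 implb (GRing.Implies f1 f2) (fun=> erefl) (IH1 q1 r1) (IH2 q2 r2)).
- move=> f1 IH1 q1 r1.
  pose neg (b _ : bool) := ~~ b.
  exact: (comb f1 f1 neg (GRing.Not f1) (fun=> erefl) (IH1 q1 r1) (IH1 q1 r1)).
Qed.

(** Quantifier elimination over algebraically closed fields reduces to the
    quantifier-free case. *)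
Lemma definable_generic n (f : GRing.formula F) :
  exists2 p : ipoly n, p != 0 &
    (forall e, size e = n -> ieval n e p != 0 -> GRing.holds e f) \/
    (forall e, size e = n -> ieval n e p != 0 -> ~ GRing.holds e f).
Proof.
pose wf := @ClosedFieldQE.wf_ex_elim F.
pose ok := @ClosedFieldQE.holds_ex_elim F (@solve_monicpoly F).
pose g := GRing.quantifier_elim (@ClosedFieldQE.ex_elim F) (GRing.to_rform f).
have gP e : reflect (GRing.holds e f) (GRing.qf_eval e g).
  exact: (GRing.proj_satP wf ok).
have /andP[qg rg] : GRing.qf_form g && GRing.rformula g.
  exact/(GRing.quantifier_elim_wf wf)/GRing.to_rform_rformula.
have [p [[] [p0 hp]]] := qf_generic n _ qg rg; exists p => //; [left|right] => e se pe.
  by apply/gP; rewrite hp.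
by move=> /gP; rewrite hp.
Qed.

End Definable.

Set Implicit Arguments.
Unset Strict Implicit.

(** * Zero sets of polynomials are Lebesgue null *)

Section NullZeroSets.
Context (R : realType).
Local Notation plane := (measurableTypeR R * measurableTypeR R)%type.
Local Notation C := R[i].

Definition to_complex (z : plane) : C := Complex z.1 z.2.

Lemma complexReD (x y : C) : complex.Re (x + y) = complex.Re x + complex.Re y.
Proof. by case: x y => ? ? []. Qed.

Lemma complexImD (x y : C) : complex.Im (x + y) = complex.Im x + complex.Im y.
Proof. by case: x y => ? ? []. Qed.

Lemma complexReM (x y : C) :
  complex.Re (x * y) = complex.Re x * complex.Re y - complex.Im x * complex.Im y.
Proof. by case: x y => ? ? []. Qed.

Lemma complexImM (x y : C) :
  complex.Im (x * y) = complex.Re x * complex.Im y + complex.Im x * complex.Re y.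
Proof. by case: x y => ? ? []. Qed.

Definition cmeasurable d (T : measurableType d) (f : T -> C) : Prop :=
  measurable_fun setT (fun x => complex.Re (f x) : measurableTypeR R) /\
  measurable_fun setT (fun x => complex.Im (f x) : measurableTypeR R).

Section Closure.
Context d (T : measurableType d).

Lemma cmeasurable_cst (c : C) : cmeasurable (fun _ : T => c).
Proof. by split; exact: measurable_cst. Qed.

Lemma cmeasurableD (f g : T -> C) :
  cmeasurable f -> cmeasurable g -> cmeasurable (fun x => f x + g x).
Proof.
move=> [f1 f2] [g1 g2]; split.
  by under eq_fun do rewrite complexReD; exact: measurable_funD.
by under eq_fun do rewrite complexImD; exact: measurable_funD.
Qed.

Lemma cmeasurableM (f g : T -> C) :
  cmeasurable f -> cmeasurable g -> cmeasurable (fun x => f x * g x).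
Proof.
move=> [f1 f2] [g1 g2]; split.
  under eq_fun do rewrite complexReM.
  by apply: measurable_funB; exact: measurable_funM.
under eq_fun do rewrite complexImM.
by apply: measurable_funD; exact: measurable_funM.
Qed.

Lemma cmeasurableX (f : T -> C) k :
  cmeasurable f -> cmeasurable (fun x => f x ^+ k).
Proof.
move=> mf; elim: k => [|k IH]; first exact: cmeasurable_cst.
by under eq_fun do rewrite exprS; exact: cmeasurableM.
Qed.

Lemma cmeasurable_sum k (f : 'I_k -> T -> C) :
  (forall i, cmeasurable (f i)) -> cmeasurable (fun x => \sum_i f i x).
Proof.
elim: k f => [|k IH] f mf.
  by under eq_fun do rewrite big_ord0; exact: cmeasurable_cst.
under eq_fun do rewrite big_ord_recl.
by apply: cmeasurableD => //; exact: IH.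
Qed.

Lemma cmeasurable_ieval n (p : ipoly C n) (v : T -> n.-tuple plane) :
  measurable_fun setT v ->
  cmeasurable (fun x => ieval n [seq to_complex z | z <- v x] p).
Proof.
elim: n p v => [|n IH] p v mv; first exact: cmeasurable_cst.
rewrite (_ : (fun x => _) = fun x => \sum_(i < size (p : {poly ipoly C n}))
    ieval n [seq to_complex z | z <- [tuple of behead (v x)]] (p : {poly ipoly C n})`_i
    * to_complex (thead (v x)) ^+ i).
  apply: cmeasurable_sum => i; apply: cmeasurableM => /=.
    have mb : measurable_fun setT (fun x => [tuple of behead (v x)]).
      exact: (measurableT_comp (@measurable_behead _ _ _) mv).
    exact: (IH _ _ mb).
  apply: cmeasurableX.
  have mt : measurable_fun setT (fun x => thead (v x)).
    by apply: measurableT_comp => //; exact: measurable_tnth.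
  split => /=.
    by apply: (measurableT_comp (f := fst)) => //; exact: measurable_fst.
  by apply: (measurableT_comp (f := snd)) => //; exact: measurable_snd.
by apply/funext => x; case/tupleP: (v x) => z t; rewrite theadE; exact: ieval_cons.
Qed.

End Closure.

Lemma measurable_zeros n (p : ipoly C n) :
  measurable [set v : n.-tuple plane | ieval n [seq to_complex z | z <- v] p = 0].
Proof.
have [m1 m2] := @cmeasurable_ieval _ _ n p id (@measurable_id _ _ _).
rewrite (_ : [set _ | _] =
  ((fun v : n.-tuple plane => complex.Re (ieval n [seq to_complex z | z <- v] p)) @^-1` [set 0]) `&`
  ((fun v : n.-tuple plane => complex.Im (ieval n [seq to_complex z | z <- v] p)) @^-1` [set 0])).
  by apply: measurableI; rewrite -[X in measurable X]setTI; [apply: m1|apply: m2].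
apply/seteqP; split => v /=; case: (ieval _ _ _) => x y /=; first by case.
by move=> [-> ->].
Qed.

Lemma plane_null1 (z : plane) : (@lebesgue_plane R).-negligible [set z].
Proof.
have -> : [set z] = [set z.1] `*` [set z.2].
  by case: z => x y; apply/seteqP; split => [[a b] [-> ->]//|[a b] /= [-> ->]].
apply/negligibleP; first exact: measurableX.
apply: (etrans (product_measure1E (@lebesgue_measure R) (@lebesgue_measure R) _ _)).
- exact: measurable_set1.
- exact: measurable_set1.
by rewrite [X in (X * _)%E]lebesgue_measure_set1 mul0e.
Qed.

Lemma plane_null_finite (Z : set plane) :
  finite_set Z -> (@lebesgue_plane R).-negligible Z.
Proof.
move=> /finite_seqP[s ->]; elim: s => [|z s IH].
  by apply: (negligibleS _ (negligible_set0 _)) => z /=; rewrite in_nil.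
apply: (negligibleS _ (negligibleU (plane_null1 z) IH)) => w /=.
by rewrite in_cons => /orP[/eqP ->|]; [left|right].
Qed.

Lemma finite_roots n (p : {poly ipoly C n}) : p != 0 ->
  finite_set [set z : plane | p.[iconst n (to_complex z)] = 0].
Proof.
move=> p0; apply: contrapT => /(infinite_set_fset (size p))[B BZ sB].
have [|||x /mapP[z zB ->]] := @nonroot_of_uniq _ n p (map to_complex (finmap.enum_fset B)).
- exact: p0.
- by rewrite map_inj_uniq ?finmap.fset_uniq // => -[a b] [c e] [-> ->].
- by rewrite size_map.
by rewrite (BZ _ zB) eqxx.
Qed.

(** Induction by Fubini: for all but finitely many values of the first
    coordinate, substituting it leaves a nonzero polynomial in the other ones,
    whose zero set is null by induction. *)
Lemma zeros_null n (p : ipoly C n) : p != 0 ->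
  (power_measure (@lebesgue_plane R) n).-negligible
    [set v : n.-tuple plane | ieval n [seq to_complex z | z <- v] p = 0].
Proof.
elim: n p => [|n IH] p p0.
  apply: (@negligibleS _ _ _ _ set0); last exact: negligible_set0.
  by move=> v /= p00; rewrite p00 eqxx in p0.
set Z := [set v | _].
have mZ : measurable Z by exact: measurable_zeros.
apply/negligibleP => //=.
rewrite /prod_cons /pushforward /sf_prod /product_measure1.
set A := _ @^-1` Z.
have mA : measurable A.
  by rewrite -[X in measurable X]setTI; exact: measurable_tuple_of_pair.
have := @ge0_ae_eq_integral _ _ _ (@lebesgue_plane R) setT
  (power_measure (@lebesgue_plane R) n \o xsection A) (cst 0%E).
rewrite integral_cst // mul0e; apply => //.
  exact: measurable_fun_xsection.
apply: (negligibleS _ (@plane_null_finite _ (@finite_roots n p p0))).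
move=> z /=; apply: contra_notP => pz _.
have /(IH _)/negligibleP : (p : {poly ipoly C n}).[iconst n (to_complex z)] != 0 by exact/eqP.
rewrite (_ : xsection A z = [set v : n.-tuple plane | ieval n [seq to_complex z | z <- v]
    (p : {poly ipoly C n}).[iconst n (to_complex z)] = 0]).
  by apply; exact: measurable_zeros.
by apply/seteqP; split => v; rewrite /xsection /= inE.
Qed.

End NullZeroSets.

(** * Autocovariances as a bilinear form *)

Lemma box_bounds d (u v : Zvec d) (k : box u v) i : u i <= val k i <= v i.
Proof. exact: (forallP (valP k)). Qed.

Section Coordinates.
Context (d : nat).
Implicit Types (s t : Zvec d).

(** Unlike [ffunE], these keep the coordinates in the form [s i], with values of
    type [int], on which linear arithmetic relies. *)
Lemma zaddE s t i : (s + t) i = s i + t i. Proof. by rewrite ffunE. Qed.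
Lemma zoppE s i : (- s) i = - s i. Proof. by rewrite ffunE. Qed.
Lemma zzeroE i : (0 : Zvec d) i = 0. Proof. by rewrite ffunE. Qed.

Definition zE := (zaddE, zoppE, zzeroE).

End Coordinates.

Definition vscale (K : fieldType) (I : finType) (x : K) (a : {ffun I -> K}) :
  {ffun I -> K} := [ffun k => x * a k].

Section Cov.
Context (K : fieldType) (d : nat) (q : Zvec d).
Local Notation coeffs := {ffun box 0 q -> K}.

(** The polarization of [autocov], from which it is recovered on the diagonal. *)
Definition cov (a b : coeffs) (t : Zvec d) : K :=
  \sum_(p : box 0 q * box 0 q | val p.2 == val p.1 + t) a p.1 * b p.2.

Lemma covC a b t : cov a b (- t) = cov b a t.
Proof.
rewrite /cov (reindex_inj (inv_inj (@swap_pairK _ _))) /=.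
apply: eq_big => [[k l]|[k l] _] /=; last by rewrite mulrC.
by rewrite -subr_eq opprK eq_sym.
Qed.

Lemma cov_out a b t : ~~ in_box (- q) q t -> cov a b t = 0.
Proof.
move=> tq; rewrite /cov big_pred0 // => -[k l] /=; apply: contraNF tq.
move=> /eqP lk; rewrite -[t](addKr (val k)) -lk.
apply/forallP => i; rewrite !ffunE.
have := box_bounds k i; have := box_bounds l i; rewrite !zE /=; lia.
Qed.

Lemma cov_reverse a b t : cov (reverse a) (reverse b) t = cov b a t.
Proof.
rewrite /cov (reindex_inj (h := fun p : box 0 q * box 0 q => (box_rev p.2, box_rev p.1))).
  apply: eq_big => [[k l]|[k l] _] /=; last by rewrite !ffunE !box_revK mulrC.
  rewrite -subr_eq0 -[RHS]subr_eq0; congr (_ == 0).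
  by apply/ffunP => i; rewrite !zE; ring.
by apply: inv_inj => -[k l] /=; rewrite !box_revK.
Qed.

(** Of two opposite lags one is lexicographically nonnegative, and the
    autocovariances at both agree. *)
Lemma autocov_lags a b :
  (forall t : lag q, autocov a (val (val t)) = autocov b (val (val t))) ->
  forall t, cov a a t = cov b b t.
Proof.
move=> h t.
have [tq|tq] := boolP (in_box (- q) q t); last by rewrite !cov_out.
have Ntq : in_box (- q) q (- t).
  by apply/forallP => i; move: (forallP tq i); rewrite !zE /=; lia.
have [t0|t0] := boolP (lex_le 0 t).
  by have := h (Sub (Sub t tq) t0); rewrite !SubK.
have t0' : lex_le 0 (- t).
  rewrite -(lex_le_add _ _ t) add0r addNr /lex_le.
  by have /orP[] := le_total (lexvec t) (lexvec 0); rewrite // => /(negP t0).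
by rewrite -covC -[RHS]covC; have := h (Sub (Sub (- t) Ntq) t0'); rewrite !SubK.
Qed.

(** Extension by zero outside the box; sums over pairs of box indices become sums
    over one index. *)
Definition ext (a : coeffs) (k : Zvec d) : K := if insub k is Some s then a s else 0.

Lemma ext_val a (k : box 0 q) : ext a (val k) = a k.
Proof. by rewrite /ext valK. Qed.

Lemma ext_out a k : ~~ in_box 0 q k -> ext a k = 0.
Proof. by move=> kq; rewrite /ext insubN. Qed.

Lemma cov_ext a b t : cov a b t = \sum_k a k * ext b (val k + t).
Proof.
rewrite /cov -(pair_big_dep predT (fun k l : box 0 q => val l == val k + t)
   (fun k l => a k * b l)) /=; apply: eq_bigr => k _.
rewrite -mulr_sumr; congr (_ * _); rewrite /ext.
case: insubP => [l _ lk|nk]; first by rewrite (big_pred1 l) // => l'; rewrite /= -lk.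
by rewrite big_pred0 // => l; apply: contraNF nk => /eqP <-; exact: (valP l).
Qed.

End Cov.

(** * Slicing along one coordinate axis *)

Section Reversal.
Context (K : fieldType) (m : nat).

(** p |-> x^m p(1/x), for a polynomial of degree at most m. *)
Definition flip (p : {poly K}) : {poly K} := \poly_(i < m.+1) p`_(m - i).

Lemma coef_flip p i : (flip p)`_i = if (i < m.+1)%N then p`_(m - i) else 0.
Proof. by rewrite coef_poly. Qed.

Lemma size_flip p : (size (flip p) <= m.+1)%N.
Proof. exact: size_poly. Qed.

Lemma flipK (p : {poly K}) : (size p <= m.+1)%N -> flip (flip p) = p.
Proof.
move=> sp; apply/polyP => i; rewrite !coef_flip; case: ltnP => im.
  by rewrite ltnS leq_subr subKn.
by rewrite nth_default // (leq_trans sp).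
Qed.

Lemma flipZ c p : flip (c *: p) = c *: flip p.
Proof. by apply/polyP => i; rewrite !(coef_flip, coefZ); case: ifP; rewrite ?mulr0. Qed.

Lemma flip0 : flip 0 = 0.
Proof. by apply/polyP => i; rewrite coef_flip !coef0; case: ifP. Qed.

End Reversal.

Section Convolution.
Context (K : fieldType) (d : nat) (alpha : Zvec d).

(** The coefficient of y^(alpha + t) in the product of the polynomials with
    y-coefficients [S] and, in reverse order, [P]. *)
Definition xcorr (P S : Zvec d -> {poly K}) (t : Zvec d) : {poly K} :=
  \sum_(y : box 0 alpha) P (val y) * S (val y + t).

End Convolution.

Section Slices.
Context (K : fieldType) (d : nat) (q : Zvec d) (q_gt0 : forall i, 0 < q i) (i0 : 'I_d).
Local Notation coeffs := {ffun box 0 q -> K}.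

Definition axis (c : int) : Zvec d := [ffun i => if i == i0 then c else 0].
Definition transverse (k : Zvec d) : Zvec d := [ffun i => if i == i0 then 0 else k i].
Definition width : nat := `|q i0|%N.
Local Notation m := width.
Local Notation flip := (flip width).

Lemma axisE c i : axis c i = if i == i0 then c else 0. Proof. by rewrite ffunE. Qed.
Lemma transverseE k i : transverse k i = if i == i0 then 0 else k i.
Proof. by rewrite ffunE. Qed.

Let sE := (@zE d, axisE, transverseE).

Local Notation top := (transverse q).
Local Notation xcorr := (xcorr top).

Lemma widthE : m%:Z = q i0. Proof. by rewrite /width gtz0_abs. Qed.

Lemma axis_transverse k : transverse k + axis (k i0) = k.
Proof. by apply/ffunP => i; rewrite !sE; case: eqP => [->|_]; rewrite ?add0r ?addr0. Qed.

Lemma transverse_axis (y : Zvec d) c : y i0 = 0 -> transverse (y + axis c) = y.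
Proof. by move=> y0; apply/ffunP => i; rewrite !sE; case: eqP => [->|_]; rewrite ?addr0. Qed.

Lemma in_box_slice (y : Zvec d) (i : int) : in_box 0 top y ->
  in_box 0 q (y + axis i) = (0 <= i <= m%:Z).
Proof.
move=> yt; apply/forallP/idP => [/(_ i0)|im j].
  by have := forallP yt i0; rewrite !sE eqxx widthE /=; lia.
have := forallP yt j; rewrite !sE; case: eqP => [->|_]; last by rewrite addr0.
by move: im; rewrite widthE; lia.
Qed.

Lemma in_box_transverse k : in_box 0 q k -> in_box 0 top (transverse k).
Proof.
move=> kq; apply/forallP => i; have := forallP kq i; rewrite !sE.
by case: eqP.
Qed.

Lemma in_box_base (y : Zvec d) (i : int) : y i0 = 0 -> in_box 0 q (y + axis i) -> in_box 0 top y.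
Proof. by move=> y0 /in_box_transverse; rewrite transverse_axis. Qed.

Lemma top_i0 (y : Zvec d) : in_box 0 top y -> y i0 = 0.
Proof. by move=> /forallP/(_ i0); rewrite !sE eqxx /=; lia. Qed.

(** The coefficient in theta_a of the monomial with exponent [y] in the variables
    other than that of [i0]. *)
Definition slice (a : coeffs) (y : Zvec d) : {poly K} :=
  if in_box 0 top y then \poly_(i < m.+1) ext a (y + axis i%:Z) else 0.

Lemma size_slice a y : (size (slice a y) <= m.+1)%N.
Proof. by rewrite /slice; case: ifP => _; rewrite ?size_poly ?size_poly0. Qed.

Lemma slice_out a y : ~~ in_box 0 top y -> slice a y = 0.
Proof. by rewrite /slice => /negbTE ->. Qed.

Lemma coef_slice a y i : in_box 0 top y ->
  (slice a y)`_i = ext a (y + axis i%:Z).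
Proof.
move=> yt; rewrite /slice yt coef_poly; case: ltnP => // im.
by rewrite ext_out // in_box_slice //; lia.
Qed.

Lemma sum_slices (V : zmodType) (F : Zvec d -> V) :
  \sum_(k : box 0 q) F (val k) =
  \sum_(y : box 0 top) \sum_(i < m.+1) F (val y + axis i%:Z).
Proof.
rewrite pair_big /=.
have to_q (p : box 0 top * 'I_m.+1) : in_box 0 q (val p.1 + axis (p.2 : nat)%:Z).
  by rewrite in_box_slice ?(valP p.1) //; have := ltn_ord p.2; lia.
pose f (p : box 0 top * 'I_m.+1) : box 0 q := Sub _ (to_q p).
pose g (k : box 0 q) : box 0 top * 'I_m.+1 :=
  (Sub _ (in_box_transverse (valP k)), inord `|val k i0|%N).
rewrite (reindex f) /=; first by apply: eq_bigr => p _.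
apply: onW_bij; exists g.
  move=> [y i]; rewrite /g /f; congr (_, _).
    by apply/val_inj; rewrite /= transverse_axis // top_i0 // (valP y).
  apply/val_inj; rewrite /= inordK !sE eqxx (top_i0 (valP y)) add0r absz_nat //.
move=> k; apply/val_inj; rewrite /= inordK.
  have := box_bounds k i0; rewrite sE => /andP[k0 _].
  by rewrite gez0_abs // axis_transverse.
by have := box_bounds k i0; rewrite !sE /width /=; lia.
Qed.

(** The identity between the autocovariances and the coefficients of the product
    of theta_b and the reversal of theta_a, grouped by powers of the other
    variables. *)
Lemma coef_xcorr a b (t : Zvec d) j : t i0 = 0 ->
  (xcorr (fun y => flip (slice a y)) (slice b) t)`_j = cov a b (t + axis (j%:Z - m%:Z)).
Proof.
move=> t0; pose s := t + axis (j%:Z - m%:Z).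
rewrite cov_ext -/s (eq_bigr (fun k => ext a (val k) * ext b (val k + s))); last first.
  by move=> k _; rewrite ext_val.
rewrite (sum_slices (fun k => ext a k * ext b (k + s))).
rewrite /xcorr coef_sum; apply: eq_bigr => y _.
have yt := valP y; have y0 := top_i0 yt.
rewrite coefM [RHS](reindex_inj rev_ord_inj) /=.
(* The ranges i <= j and i <= m differ; compare the terms in a range containing both. *)
rewrite (big_ord_widen_cond (m + j).+1 xpredT
  (fun i => (flip (slice a (val y)))`_i * (slice b (val y + t))`_(j - i))) ?ltnS ?leq_addl //.
rewrite (big_ord_widen_cond (m + j).+1 xpredT
  (fun i => ext a (val y + axis (m.+1 - i.+1)%N%:Z) *
            ext b (val y + axis (m.+1 - i.+1)%N%:Z + s))) ?ltnS ?leq_addr //.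
rewrite big_mkcond [RHS]big_mkcond /=; apply: eq_bigr => i _.
rewrite coef_flip; case: (ltnP i m.+1) => im; last by rewrite mul0r if_same.
rewrite coef_slice // subSS.
have -> : val y + axis (m - i)%N%:Z + s =
          val y + t + axis (j%:Z - i%:Z).
  by apply/ffunP => l; rewrite /s !sE; case: eqP => // _; lia.
have [ytt|nyt] := boolP (in_box 0 top (val y + t)).
  rewrite coef_slice //; case: ltnP => ij.
    by congr (_ * ext b (_ + axis _)); lia.
  by rewrite [X in _ * X]ext_out ?mulr0 // in_box_slice //; lia.
rewrite slice_out // coef0 mulr0 if_same [X in _ * X]ext_out ?mulr0 //.
by apply: contra nyt; apply: in_box_base; rewrite sE y0 t0.
Qed.

Lemma slice_inj a b : (forall y, in_box 0 top y -> slice a y = slice b y) -> a = b.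
Proof.
move=> ab; apply/ffunP => k; rewrite -!ext_val -(axis_transverse (val k)).
have k0 : 0 <= val k i0 by have := box_bounds k i0; rewrite sE => /andP[].
rewrite -[val k i0]gez0_abs //.
by rewrite -!coef_slice ?ab // in_box_transverse // (valP k).
Qed.

Lemma ext_reverse (a : coeffs) k : ext (reverse a) k = ext a (q - k).
Proof.
have [kq|nk] := boolP (in_box 0 q k).
  by rewrite -[k]/(val (Sub k kq : box 0 q)) ext_val ffunE -ext_val.
rewrite !ext_out //; apply: contra nk => /in_box_rev; by rewrite subKr.
Qed.

Lemma slice_reverse (a : coeffs) y : slice (reverse a) y = flip (slice a (top - y)).
Proof.
have [yt|nt] := boolP (in_box 0 top y); last first.
  rewrite !slice_out ?flip0 //; apply: contra nt => /in_box_rev; by rewrite subKr.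
apply/polyP => i; rewrite coef_flip coef_slice // ext_reverse.
have tyt := in_box_rev yt.
case: ltnP => im.
  rewrite coef_slice //; congr (ext _ _); apply/ffunP => j; rewrite !sE.
  case: eqP => [->|_]; last by lia.
  by have := widthE; have := top_i0 yt; lia.
rewrite ext_out //; apply/negP => /in_box_rev; rewrite subKr in_box_slice //; lia.
Qed.

Definition of_slices (S : Zvec d -> {poly K}) : coeffs :=
  [ffun k : box 0 q => (S (transverse (val k)))`_`|val k i0|%N].

Lemma slice_of_slices (S : Zvec d -> {poly K}) (y : Zvec d) :
  in_box 0 top y -> (size (S y) <= m.+1)%N -> slice (of_slices S) y = S y.
Proof.
move=> yt sS; apply/polyP => i; rewrite coef_slice //.
have [im|im] := boolP (in_box 0 q (y + axis i%:Z)).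
  rewrite -[y + _]/(val (Sub (y + axis i%:Z) im : box 0 q)) ext_val ffunE /=.
    by rewrite transverse_axis ?(top_i0 yt) // !sE eqxx (top_i0 yt) add0r absz_nat.
rewrite ext_out // nth_default // (leq_trans sS) //.
by move: im; rewrite in_box_slice //; lia.
Qed.

End Slices.

(** * The special polynomial *)

Section Corner.
Context (K : numFieldType) (d : nat) (alpha : Zvec d) (m : nat).
Hypotheses (m_gt0 : (0 < m)%N) (alpha_ge0 : forall i, 0 <= alpha i).
Hypothesis alpha_neq0 : alpha != 0.
Local Notation flip := (@flip K m).
Local Notation xcorr := (xcorr alpha).
Local Notation inbox := (in_box 0 alpha).
Implicit Types (P S : Zvec d -> {poly K}) (p r : {poly K}) (y t k : Zvec d).

(** The special polynomial is edge0 + edge1 y^alpha, and its reversal is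
    edge1r + edge0r y^alpha.  The constants are chosen so that
    edge0r edge1 = 1 - 4 x^(2m) has no multiple root and is not proportional to its
    own reversal. *)
Definition edge0 : {poly K} := 'X^m - 2%:P.
Definition edge1 : {poly K} := 2 *: 'X^m + 1.
Definition edge0r : {poly K} := 1 - 2 *: 'X^m.
Definition edge1r : {poly K} := 'X^m + 2%:P.

Definition corner y : {poly K} :=
  if y == 0 then edge0 else if y == alpha then edge1 else 0.

Let m0 : (0 == m)%N = false. Proof. by case: m m_gt0. Qed.
Let m0' : (m == 0)%N = false. Proof. by case: m m_gt0. Qed.

Definition edge_coefE := (coefB, coefD, coefN, coefZ, coefXn, coefC, coef1).

Lemma coef0E : (edge0`_0 = -2) * (edge1`_0 = 1) * (edge0r`_0 = 1) * (edge1r`_0 = 2).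
Proof. by rewrite !edge_coefE /= m0 /= mulr0 ?add0r ?subr0. Qed.

Lemma coefmE : (edge0`_m = 1) * (edge1`_m = 2) * (edge0r`_m = -2) * (edge1r`_m = 1).
Proof. by rewrite !edge_coefE eqxx m0' /= mulr1 ?addr0 ?sub0r ?subr0. Qed.

Lemma size_edges :
  [/\ size edge0 = m.+1, size edge1 = m.+1, size edge0r = m.+1 & size edge1r = m.+1].
Proof.
have aux p : p`_m != 0 -> (forall i, (m < i)%N -> p`_i = 0) -> size p = m.+1.
  move=> pm ph; apply/eqP; rewrite eqn_leq; apply/andP; split.
    by apply/leq_sizeP => i; exact: ph.
  by rewrite ltnNge; apply: contra pm => sp; rewrite nth_default.
have n2 : (2 : K) != 0 by rewrite pnatr_eq0.
split; apply: aux; rewrite ?coefmE ?oppr_eq0 ?oner_neq0 // => i mi;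
  rewrite !edge_coefE (gtn_eqF mi) (gtn_eqF (leq_ltn_trans (leq0n _) mi)) /=;
  by rewrite ?mulr0 ?addr0 ?subr0.
Qed.

(** Both edges have only the two extreme coefficients, which reversal exchanges. *)
Lemma flip_two_terms p r : (forall i, (0 < i < m)%N -> p`_i = 0) -> (size p <= m.+1)%N ->
  (forall i, (0 < i < m)%N -> r`_i = 0) -> (size r <= m.+1)%N ->
  p`_0 = r`_m -> p`_m = r`_0 -> flip p = r.
Proof.
move=> p0 sp r0 sr p0m pm0; apply/polyP => i; rewrite coef_flip; case: ltnP => im; last first.
  by rewrite nth_default // (leq_trans sr).
have [->|i0] := posnP i; first by rewrite subn0.
move: im; rewrite ltnS leq_eqVlt => /orP[/eqP ->|im]; first by rewrite subnn.
by rewrite p0 ?r0 ?i0 //; lia.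
Qed.

Lemma flip_edge0 : flip edge0 = edge0r.
Proof.
have [s1 s2 s3 s4] := size_edges; apply: flip_two_terms; rewrite ?s1 ?s2 ?s3 ?s4 ?coef0E ?coefmE //;
  by move=> i /andP[i0 im]; rewrite !edge_coefE (gtn_eqF i0) (ltn_eqF im) /= ?mulr0 ?subr0 ?addr0.
Qed.

Lemma flip_edge1 : flip edge1 = edge1r.
Proof.
have [s1 s2 s3 s4] := size_edges; apply: flip_two_terms; rewrite ?s1 ?s2 ?s3 ?s4 ?coef0E ?coefmE //;
  by move=> i /andP[i0 im]; rewrite !edge_coefE (gtn_eqF i0) (ltn_eqF im) /= ?mulr0 ?subr0 ?addr0.
Qed.

Lemma coprime_edge : coprimep edge0 edge1.
Proof.
apply/Bezout_coprimepP; exists (2%:P, -1).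
have -> : (2%:P, -1).1 * edge0 + (2%:P, -1).2 * edge1 = (- 5%:R)%:P.
  by rewrite /= /edge0 /edge1 -mul_polyC !polyCN !polyCMn !polyC1 => *; ring.
by rewrite polyC_eqp1 oppr_eq0 pnatr_eq0.
Qed.

Lemma coprime_edger : coprimep edge0r edge1r.
Proof.
apply/Bezout_coprimepP; exists (1, 2%:P).
have -> : (1, 2%:P).1 * edge0r + (1, 2%:P).2 * edge1r = (5%:R)%:P.
  by rewrite /= /edge0r /edge1r -mul_polyC !polyCMn !polyC1 => *; ring.
by rewrite polyC_eqp1 pnatr_eq0.
Qed.

(** Bezout identity for W = 1 - 4 x^(2m) and its derivative:
    2m W - x W' = 2m. *)
Lemma separable_edges : separable_poly (edge0r * edge1).
Proof.
have -> : edge0r * edge1 = 1 - 4%:P * 'X^(m + m).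
  by rewrite /edge0r /edge1 -!mul_polyC !polyCMn !polyC1 exprD => *; ring.
rewrite separable_poly.unlock; apply/Bezout_coprimepP; exists ((m + m)%:R, - 'X) => /=.
rewrite derivB derivM derivXn -polyC1 !derivC polyC1 mul0r !add0r.
have -> : (m + m)%:R * (1 - 4%:P * 'X^(m + m)) + - 'X * - (4%:P * ('X^((m + m).-1) *+ (m + m)))
   = (m + m)%:R :> {poly K}.
  have -> : 'X^(m + m) = 'X * 'X^((m + m).-1) :> {poly K}.
    by rewrite -exprS prednK // addn_gt0 m_gt0.
  by rewrite !polyCMn !polyC1 -[_ *+ (m + m)]mulr_natl; ring.
by rewrite -polyC_natr polyC_eqp1 pnatr_eq0 addn_eq0 m0'.
Qed.

Lemma coprime_edges : coprimep edge0r edge1.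
Proof. by move: separable_edges; rewrite separable_mul => /and3P[]. Qed.

Lemma sum_delta (V : zmodType) (F : Zvec d -> V) u : (~~ inbox u -> F u = 0) ->
  \sum_(y : box 0 alpha) (if val y == u then F (val y) else 0) = F u.
Proof.
move=> Fu; rewrite -big_mkcond /=; have [ub|nu] := boolP (inbox u).
  by rewrite (big_pred1 (Sub u ub : box 0 alpha)).
by rewrite Fu // big_pred0 // => y; apply: contraNF nu => /eqP <-; exact: (valP y).
Qed.

Lemma inbox0 : inbox 0.
Proof. by apply/forallP => i; rewrite !zE lexx alpha_ge0. Qed.

Lemma inboxa : inbox alpha.
Proof. by apply/forallP => i; rewrite !zE lexx alpha_ge0. Qed.

Lemma corner_delta y : corner y = (if y == 0 then edge0 else 0) + (if y == alpha then edge1 else 0).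
Proof.
rewrite /corner; case: (eqVneq y 0) => [->|_]; last by rewrite add0r.
by rewrite eq_sym (negbTE alpha_neq0) addr0.
Qed.

Lemma corner_out y : ~~ inbox y -> corner y = 0.
Proof.
rewrite /corner; case: eqP => [->|_]; first by rewrite inbox0.
by case: eqP => [->|//]; rewrite inboxa.
Qed.

Lemma size_corner y : (size (corner y) <= m.+1)%N.
Proof.
have [s1 s2 _ _] := size_edges.
by rewrite /corner; do 2?case: ifP => _; rewrite ?s1 ?s2 ?size_poly0.
Qed.

Lemma flip_corner y :
  flip (corner y) = (if y == 0 then edge0r else 0) + (if y == alpha then edge1r else 0).
Proof.
rewrite /corner; case: (eqVneq y 0) => [->|_].
  by rewrite flip_edge0 eq_sym (negbTE alpha_neq0) addr0.
by case: eqP => _; rewrite ?flip_edge1 ?flip0 add0r.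
Qed.

Lemma xcorr_cornerL S t :
  xcorr (fun y => flip (corner y)) S t = edge0r * S t + edge1r * S (t + alpha).
Proof.
have h0 := @sum_delta _ (fun y => edge0r * S (y + t)) 0.
have ha := @sum_delta _ (fun y => edge1r * S (y + t)) alpha.
rewrite /= add0r in h0; rewrite [t + _]addrC -h0 ?inbox0 // -ha ?inboxa // -big_split /=.
apply: eq_bigr => y _; rewrite flip_corner mulrDl.
by congr (_ + _); case: eqP; rewrite ?mul0r.
Qed.

Lemma xcorr_cornerR P t : (forall y, ~~ inbox y -> P y = 0) ->
  xcorr P corner t = P (- t) * edge0 + P (alpha - t) * edge1.
Proof.
move=> Pout.
have h0 := @sum_delta _ (fun y => P y * edge0) (- t).
have ha := @sum_delta _ (fun y => P y * edge1) (alpha - t).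
rewrite /= in h0 ha; rewrite -h0 => [|/Pout ->]; last by rewrite mul0r.
rewrite -ha => [|/Pout ->]; last by rewrite mul0r.
rewrite -big_split /=; apply: eq_bigr => y _; rewrite corner_delta mulrDr.
rewrite addr_eq0 [_ + t == alpha]eq_sym -subr_eq [_ - t == _]eq_sym.
by congr (_ + _); [case: (_ == - t)|case: (_ == alpha - t)]; rewrite ?mulr0.
Qed.

(** Total degree of a y-exponent, the induction measure for [fiber_proportional]. *)
Let wt k : nat := (\sum_i `|k i|)%N.

Lemma wt0 k : wt k = 0%N -> k = 0.
Proof.
move=> /eqP; rewrite sum_nat_eq0 => /forallP k0; apply/ffunP => i.
by rewrite zzeroE; apply/eqP; have := k0 i; rewrite absz_eq0.
Qed.

Lemma wtB y k : (forall i, 0 <= y i <= k i) -> (wt y + wt (k - y)%R)%N = wt k.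
Proof.
move=> yk; rewrite -big_split; apply: eq_bigr => i _.
by have := yk i; rewrite !zE /=; lia.
Qed.

(** Only the exponents below [k] contribute to the correlation at lag
    [alpha - k]. *)
Lemma inbox_shift y k : inbox y -> inbox (y + (alpha - k)) -> forall i, 0 <= y i <= k i.
Proof.
move=> yb yk i; have := forallP yb i; have := forallP yk i; rewrite !zE /=; lia.
Qed.

Lemma inbox_le y k : inbox k -> (forall i, 0 <= y i <= k i) -> inbox (k - y).
Proof.
move=> kb yk; apply/forallP => i; have := forallP kb i; have := yk i.
by rewrite !zE /=; lia.
Qed.

Lemma box_above y k : inbox k -> (forall i, 0 <= y i <= k i) -> y = alpha -> k = alpha.
Proof.
move=> kb yk ya; apply/ffunP => i; have := forallP kb i; have := yk i.
by rewrite ya !zE /=; lia.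
Qed.

Lemma box_below y k : inbox k -> (forall i, 0 <= y i <= k i) -> k - y = alpha -> y = 0.
Proof.
move=> kb yk ya; apply/ffunP => i; have := forallP kb i; have := yk i.
by rewrite -ya !zE /=; lia.
Qed.

Lemma inbox_add y : inbox y -> inbox (y + alpha) -> y = 0.
Proof.
move=> yb; have := @inbox_shift y 0 yb; rewrite subr0 => h /h y0; apply/ffunP => i.
by have := y0 i; rewrite !zE /=; lia.
Qed.

Lemma inbox_sub y : inbox y -> inbox (y - alpha) -> y = alpha.
Proof.
move=> yb /inbox_add; rewrite subrK => /(_ yb)/eqP; rewrite subr_eq0.
by move/eqP.
Qed.

Lemma alpha_lag k : inbox k -> in_box (- alpha) alpha (alpha - k).
Proof.
move=> kb; apply/forallP => i; have := forallP kb i; rewrite !zE /=; lia.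
Qed.

Section Fiber.
Variable S : Zvec d -> {poly K}.
Hypothesis S_out : forall y, ~~ inbox y -> S y = 0.
Hypothesis size_S : forall y, (size (S y) <= m.+1)%N.
Let P y := flip (S y).

Let P_out y : ~~ inbox y -> P y = 0.
Proof. by move=> yb; rewrite /P S_out // flip0. Qed.

Let SP y : S y = flip (P y). Proof. by rewrite flipK. Qed.

Lemma xcorr_top (T : Zvec d -> {poly K}) :
  xcorr T S alpha = T 0 * S alpha.
Proof.
rewrite /xcorr (bigD1 (Sub 0 inbox0 : box 0 alpha)) //= add0r big1 ?addr0 //.
move=> y y0; rewrite [S _]S_out ?mulr0 //; apply: contra y0.
by move=> /(inbox_add (valP y)) y0; apply/eqP/val_inj.
Qed.

Lemma xcorr_bottom (T : Zvec d -> {poly K}) :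
  xcorr T S (- alpha) = T alpha * S 0.
Proof.
rewrite /xcorr (bigD1 (Sub alpha inboxa : box 0 alpha)) //= subrr big1 ?addr0 //.
move=> y y0; rewrite [S _]S_out ?mulr0 //; apply: contra y0.
by move=> /(inbox_sub (valP y)) y0; apply/eqP/val_inj.
Qed.

Lemma coef_top_mul p r : (size p <= m.+1)%N -> (size r <= m.+1)%N ->
  (p * r)`_(m + m) = p`_m * r`_m.
Proof.
move=> sp sr; rewrite coefM (bigD1 (inord m)) //= inordK ?ltnS ?leq_addl // addKn.
rewrite big1 ?addr0 // => i im.
have [lmi|lim] := ltnP m i; first by rewrite nth_default ?mul0r // (leq_trans sp).
rewrite [r`__]nth_default ?mulr0 // (leq_trans sr) //.
have : (i : nat) != m.
  by apply: contra im => /eqP im; apply/eqP/val_inj; rewrite /= inordK // ltnS leq_addl.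
lia.
Qed.

Section Equal.
Hypothesis H : forall t, in_box (- alpha) alpha t ->
  xcorr P S t = xcorr (fun y => flip (corner y)) corner t.

Let two_alpha : alpha + alpha != 0 /\ alpha + alpha != alpha.
Proof.
split; last by rewrite -subr_eq0 addrK.
apply: contra alpha_neq0 => /eqP/ffunP a2; apply/eqP/ffunP => i.
by have := a2 i; rewrite !zE /=; lia.
Qed.

Lemma fiber_top : P 0 * S alpha = edge0r * edge1.
Proof.
rewrite -xcorr_top // H; last by rewrite -{3}[alpha]subr0 alpha_lag // inbox0.
have [a0 a1] := two_alpha.
rewrite xcorr_cornerL /corner (negbTE alpha_neq0) eqxx (negbTE a0) (negbTE a1).
by rewrite mulr0 addr0.
Qed.

Lemma fiber_bottom : P alpha * S 0 = edge1r * edge0.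
Proof.
have oa : inbox (- alpha) -> alpha = 0.
  by move=> aN; symmetry; apply: inbox_sub; rewrite ?inbox0 // sub0r.
rewrite -xcorr_bottom // H; last first.
  by apply/forallP => i; have := alpha_ge0 i; rewrite !zE /=; lia.
rewrite xcorr_cornerL addNr [corner 0]/corner eqxx [corner _]corner_out ?mulr0 ?add0r //.
by apply/negP => /oa /eqP; exact/negP.
Qed.

Lemma fiber_mid k : inbox k -> k != 0 -> k != alpha -> xcorr P S (alpha - k) = 0.
Proof.
move=> kb k0 ka; rewrite H ?alpha_lag // xcorr_cornerL.
have ak0 : (alpha - k == 0) = false by rewrite subr_eq0 eq_sym (negbTE ka).
have aka : (alpha - k == alpha) = false.
  by rewrite -subr_eq0 addrAC subrr add0r oppr_eq0 (negbTE k0).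
have akaa : (alpha - k + alpha == alpha) = false.
  by rewrite -subr_eq0 addrK ak0.
rewrite /corner ak0 aka akaa mulr0 add0r.
case: eqP => [ak|_]; last by rewrite mulr0.
case/eqP: ka; apply/ffunP => i; have := forallP kb i.
by have := congr1 (fun f : Zvec d => f i) ak; rewrite !zE /=; have := alpha_ge0 i; lia.
Qed.

Let cop : coprimep (P 0) (S alpha).
Proof. by move: separable_edges; rewrite -fiber_top separable_mul => /and3P[]. Qed.

Let end0 : (P 0)`_0 * (S alpha)`_0 = 1.
Proof. by rewrite -coef0M fiber_top coef0M !coef0E mulr1. Qed.

Let endm : (P 0)`_m * (S alpha)`_m = -4.
Proof.
have [s1 s2 s3 s4] := size_edges.
rewrite -coef_top_mul ?size_flip // fiber_top coef_top_mul ?s2 ?s3 // !coefmE; ring.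
Qed.

Lemma full_size p : (size p <= m.+1)%N -> p`_m != 0 -> size p = m.+1.
Proof.
move=> sp pm; apply/eqP; rewrite eqn_leq sp ltnNge.
by apply: contra pm => sp'; rewrite nth_default.
Qed.

Lemma dvdp_scale p r : size p = m.+1 -> (size r <= m.+1)%N -> p %| r ->
  exists c, r = c *: p.
Proof.
move=> sp sr /dvdpP[u ru]; have p0 : p != 0 by rewrite -size_poly_gt0 sp.
have [u0|u0] := eqVneq u 0; first by exists 0; rewrite ru u0 mul0r scale0r.
exists u`_0; rewrite ru -mul_polyC -size1_polyC //.
by have := sr; rewrite ru size_mul // sp addnS /= -add1n leq_add2r.
Qed.

Let sP0 : size (P 0) = m.+1.
Proof.
apply: full_size; rewrite ?size_flip //; apply/eqP => p0; move/eqP: endm.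
by rewrite p0 mul0r eq_sym oppr_eq0 pnatr_eq0.
Qed.

Let P0_neq0 : P 0 != 0. Proof. by rewrite -size_poly_gt0 sP0. Qed.

(** The correlation at lag [alpha - k] vanishes.  By induction all its terms but
    P_0 S_(alpha - k) and P_k S_alpha are multiples of P_0 S_alpha, so P_0 divides
    P_k S_alpha, hence P_k since P_0 and S_alpha are coprime; as P_0 has full
    degree m, the quotient is a constant. *)
Lemma fiber_proportional n k : (wt k < n)%N -> inbox k -> k != alpha ->
  (exists c, P k = c *: P 0) /\ (exists c, S (alpha - k) = c *: S alpha).
Proof.
elim: n k => // n IH k kn kb ka.
have [->|k0] := eqVneq k 0.
  by split; exists 1; rewrite scale1r // subr0.
have := fiber_mid kb k0 ka; rewrite /xcorr.
rewrite (bigD1 (Sub 0 inbox0 : box 0 alpha)) //= add0r.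
rewrite (bigD1 (Sub k kb : box 0 alpha)) //=.
rewrite [k + _]addrC subrK.
set rest := \sum_(_ | _) _.
have [c ->] : exists c, rest = c *: (P 0 * S alpha).
  rewrite /rest; elim/big_ind: _ => [|p r [c ->] [e ->]|y /andP[y0 yk]].
  - by exists 0; rewrite scale0r.
  - by exists (c + e); rewrite scalerDl.
  have [yb|nyb] := boolP (inbox (val y + (alpha - k))); last first.
    by exists 0; rewrite [S _]S_out // mulr0 scale0r.
  have y0' : val y != 0 by apply: contra y0 => /eqP y0; apply/eqP/val_inj.
  have yk' : val y != k by apply: contra yk => /eqP yk; apply/eqP/val_inj.
  have ley := inbox_shift (valP y) yb; have wtE := wtB ley.
  have wy : (0 < wt (val y))%N by rewrite lt0n; apply: contra y0' => /eqP/wt0 ->.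
  have wky : (0 < wt (k - val y)%R)%N.
    by rewrite lt0n; apply: contra yk' => /eqP/wt0/eqP; rewrite subr_eq0 eq_sym.
  have ya : val y != alpha.
    by apply: contra ka => /eqP ya; rewrite (box_above kb ley ya).
  have kya : k - val y != alpha.
    by apply: contra y0' => /eqP /(box_below kb ley) ->.
  have [wyn wkyn] : (wt (val y) < n)%N /\ (wt (k - val y)%R < n)%N.
    move: kn; rewrite -wtE; move: wy wky.
    move: (wt (val y)) (wt (k - val y)) => u v; clear; lia.
  have [[c cE] _] := IH _ wyn (valP y) ya.
  have [_ [e eE]] := IH _ wkyn (inbox_le kb ley) kya.
  exists (c * e); rewrite cE (_ : val y + _ = alpha - (k - val y)) ?eE.
    by rewrite -scalerAl -scalerAr scalerA.
  by rewrite opprB addrCA.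
move=> E.
have E' : P k * S alpha = P 0 * - (S (alpha - k) + c *: S alpha).
  by move/eqP: E; rewrite addrCA addr_eq0 => /eqP ->; rewrite mulrN mulrDr scalerAr.
have [|e eE] := @dvdp_scale (P 0) (P k) sP0 (size_flip _ _).
  by rewrite -(Gauss_dvdpl _ cop) E' dvdp_mulr.
split; first by exists e.
exists (- e - c); move: E'; rewrite eE -scalerAl scalerAr => /(mulfI P0_neq0) eS.
by rewrite scalerBl scaleNr eS opprK addrK.
Qed.

(** By [fiber_proportional] at [k] and at [alpha - k], S_k is a multiple of both S_0 and
    S_alpha.  Were it nonzero, P_0 S_alpha would be proportional to P_0 S_0,
    which equals its own reversal, unlike 1 - 4 x^(2m). *)
Lemma fiber_zero k : inbox k -> k != 0 -> k != alpha -> S k = 0.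
Proof.
move=> kb k0 ka.
have [[c cE] _] := fiber_proportional (ltnSn _) kb ka.
have kb' : inbox (alpha - k) by apply: in_box_rev.
have ka' : alpha - k != alpha.
  by rewrite -subr_eq0 addrAC subrr add0r oppr_eq0.
have [_ [e eE]] := fiber_proportional (ltnSn _) kb' ka'.
rewrite subKr in eE.
have cS : S k = c *: S 0 by rewrite SP cE flipZ -SP.
apply/eqP/contraT => Sk.
have c0 : c != 0 by apply: contra Sk => /eqP c0; rewrite cS c0 scale0r.
have S0 : S 0 = (c^-1 * e) *: S alpha by rewrite -scalerA -eE cS scalerA mulVf // scale1r.
have : 1 = -4 :> K.
  have P00 : (P 0)`_0 = (S 0)`_m by rewrite coef_flip subn0.
  have P0m : (P 0)`_m = (S 0)`_0 by rewrite coef_flip ltnSn subnn.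
  by rewrite -[LHS]end0 -endm P00 P0m S0 !coefZ -!mulrA [X in _ * (_ * X)]mulrC.
by move/eqP; rewrite -subr_eq0 opprK -(natrD _ 1 4) pnatr_eq0.
Qed.

Lemma fiber_origin : P 0 * S 0 + P alpha * S alpha = edge0r * edge0 + edge1r * edge1.
Proof.
have := @H 0; rewrite xcorr_cornerL add0r /corner eqxx (negbTE alpha_neq0) eqxx => <-.
  rewrite /xcorr (bigD1 (Sub 0 inbox0 : box 0 alpha)) //= addr0.
  rewrite (bigD1 (Sub alpha inboxa : box 0 alpha)) //= addr0 big1 ?addr0 //.
  move=> y /andP[y0 ya]; rewrite addr0 (@fiber_zero (val y)) ?mulr0 ?(valP y) //.
by rewrite -(subrr alpha) alpha_lag ?inboxa.
Qed.

(** The pairs P_0 S_0, P_alpha S_alpha and edge0r edge0, edge1r edge1 have the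
    same sum and the same product. *)
Lemma fiber_split : P 0 * S 0 = edge0r * edge0 \/ P 0 * S 0 = edge1r * edge1.
Proof.
have : (P 0 * S 0 - edge0r * edge0) * (P 0 * S 0 - edge1r * edge1) = 0.
  have -> : (P 0 * S 0 - edge0r * edge0) * (P 0 * S 0 - edge1r * edge1) =
    P 0 * S 0 * (P 0 * S 0 - (edge0r * edge0 + edge1r * edge1)) +
    (edge0r * edge1) * (edge1r * edge0) by ring.
  by rewrite -fiber_origin -fiber_top -fiber_bottom; ring.
by move/eqP; rewrite mulf_eq0 !subr_eq0 => /orP[] /eqP; [left|right].
Qed.

(** P_0 divides edge0r edge1 by [fiber_top], and edge0r edge0 or edge1r edge1 by
    [fiber_split].  Coprimality of the edges leaves it a divisor of edge0r in the
    first case and of edge1 in the second; having the same degree, it is a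
    constant multiple. *)
Lemma fiber_corner : exists2 c : K, c ^+ 2 = 1 &
  (forall y, inbox y -> S y = c *: corner y) \/
  (forall y, inbox y -> S y = c *: flip (corner (alpha - y))).
Proof.
have [sA sB sA' sB'] := size_edges.
have endgame (p r p' : {poly K}) : flip p' = p -> size p' = m.+1 -> size p = m.+1 ->
    coprimep p r -> P 0 * S 0 = p' * p -> P 0 * S alpha = p' * r ->
    exists2 c, c ^+ 2 = 1 & S 0 = c *: p /\ S alpha = c *: r.
  move=> flip_p' sp' sp pr E0 Er.
  have p'0 : p' != 0 by rewrite -size_poly_gt0 sp'.
  have pp0 : p != 0 by rewrite -size_poly_gt0 sp.
  have d1 : P 0 %| p'.
    have : P 0 %| gcdp (p' * p) (p' * r) by rewrite dvdp_gcd -E0 -Er !dvdp_mulr.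
    rewrite (eqp_dvdr _ (gcdp_mul2l _ _ _)) => h; apply: dvdp_trans h _.
    by rewrite -[X in _ %| X]mulr1 dvdp_mul2l // dvdp1.
  have [|e p'E] := dvdp_scale sP0 _ d1; first by rewrite sp'.
  have e0 : e != 0 by apply: contra p'0 => /eqP e0; rewrite p'E e0 scale0r.
  have P0E : P 0 = e^-1 *: p' by rewrite p'E scalerA mulVf // scale1r.
  have S0E : S 0 = e^-1 *: p by rewrite SP P0E flipZ flip_p'.
  have e2 : e^-1 ^+ 2 = 1.
    move: E0; rewrite P0E S0E -scalerAl -scalerAr scalerA => /eqP.
    rewrite -subr_eq0 -{2}[p' * p]scale1r -scalerBl scaler_eq0 mulf_eq0.
    by rewrite (negbTE p'0) (negbTE pp0) !orbF subr_eq0 => /eqP; rewrite expr2.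
  exists e^-1 => //; split=> //.
  move: Er; rewrite P0E -scalerAl scalerAr => /(mulfI p'0) <-.
  by rewrite scalerA -expr2 e2 scale1r.
have rest c (T : Zvec d -> {poly K}) : S 0 = c *: T 0 -> S alpha = c *: T alpha ->
    (forall y, y != 0 -> y != alpha -> T y = 0) -> forall y, inbox y -> S y = c *: T y.
  move=> S0 Sa T0 y yb; have [->//|y0] := eqVneq y 0; have [->//|ya] := eqVneq y alpha.
  by rewrite fiber_zero // T0 // scaler0.
have [E|E] := fiber_split.
  have flipA' : flip edge0r = edge0 by rewrite -flip_edge0 flipK ?sA.
  have [c c2 [S0 Sa]] := endgame _ _ _ flipA' sA' sA coprime_edge E fiber_top.
  exists c => //; left; apply: rest.
  - by rewrite /corner eqxx.
  - by rewrite /corner (negbTE alpha_neq0) eqxx.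
  - by move=> y y0 ya; rewrite /corner (negbTE y0) (negbTE ya).
have E' : P 0 * S 0 = edge1 * edge1r by rewrite E mulrC.
have coB'A' : coprimep edge1r edge0r by rewrite coprimep_sym; exact: coprime_edger.
have top' : P 0 * S alpha = edge1 * edge0r by rewrite fiber_top mulrC.
have [c c2 [S0 Sa]] := endgame _ _ _ flip_edge1 sB sB' coB'A' E' top'.
exists c => //; right; apply: (rest c (fun y => flip (corner (alpha - y)))).
- by rewrite subr0 /corner (negbTE alpha_neq0) eqxx flip_edge1.
- by rewrite subrr /corner eqxx flip_edge0.
move=> y y0 ya; rewrite /corner subr_eq0 eq_sym (negbTE ya).
by rewrite -subr_eq0 addrAC subrr add0r oppr_eq0 (negbTE y0) flip0.
Qed.

End Equal.

(** The same divisibility argument for the linearized equations: at lag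
    [alpha - k] it gives P_k = c edge0r and S_(alpha - k) = - c edge1.  In the middle
    this makes S_k a multiple of both edge0 and edge1, which are not
    proportional; at the ends the equation at lag 0 becomes
    2 c (edge0r edge0 - edge1r edge1) = 0, where the two products have the constant
    coefficients -2 and 2. *)
Lemma corner_rigid :
  (forall t, in_box (- alpha) alpha t ->
    xcorr (fun y => flip (corner y)) S t + xcorr P corner t = 0) ->
  forall y, S y = 0.
Proof.
have [sA sB sA' sB'] := size_edges.
move=> E.
have E1 k : inbox k -> k != alpha -> exists c, P k = c *: edge0r /\ S (alpha - k) = - c *: edge1.
  move=> kb ka; have := E _ (alpha_lag kb).
  rewrite xcorr_cornerL xcorr_cornerR // opprB [alpha + (k - alpha)]addrC subrK.
  rewrite [S (_ + alpha)]S_out; last first.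
    apply: contra ka => /forallP k2; apply/eqP/ffunP => i.
    by have := k2 i; have := forallP kb i; rewrite !zE /=; lia.
  rewrite [P (k - alpha)]P_out; last first.
    apply: contra ka => /forallP k2; apply/eqP/ffunP => i.
    by have := k2 i; have := forallP kb i; rewrite !zE /=; lia.
  rewrite mulr0 addr0 mul0r add0r => /eqP; rewrite addr_eq0 => /eqP E2.
  have dv : edge0r %| P k.
    by rewrite -(Gauss_dvdpl _ coprime_edges) -[_ * edge1]opprK -E2 dvdpNr dvdp_mulr.
  have [c cE] := dvdp_scale sA' (size_flip _ _) dv.
  exists c; split=> //; apply: (@mulfI _ edge0r); first by rewrite -size_poly_gt0 sA'.
  by rewrite E2 [P k]cE -scalerAl -scalerAr scaleNr.
have flipA' : flip edge0r = edge0 by rewrite -flip_edge0 flipK ?sA.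
have mid k : inbox k -> k != 0 -> k != alpha -> S k = 0.
  move=> kb k0 ka; have [c [cE _]] := E1 _ kb ka.
  have kb' : inbox (alpha - k) by apply: in_box_rev.
  have ka' : alpha - k != alpha by rewrite -subr_eq0 addrAC subrr add0r oppr_eq0.
  have [e [_ eE]] := E1 _ kb' ka'; rewrite subKr in eE.
  have SA : S k = c *: edge0 by rewrite SP cE flipZ flipA'.
  have h0 : c * -2 = - e * 1.
    by have := congr1 (fun p : {poly K} => p`_0) SA; rewrite eE !coefZ !coef0E => ->.
  have hm : c * 1 = - e * 2.
    by have := congr1 (fun p : {poly K} => p`_m) SA; rewrite eE !coefZ !coefmE => ->.
  suff c0 : c = 0 by rewrite SA c0 scale0r.
  have : 5 * c = (c * 1 - - e * 2) - 2 * (c * -2 - - e * 1) by ring.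
  rewrite hm h0 !subrr mulr0 subr0 => /eqP.
  by rewrite mulf_eq0 pnatr_eq0 => /eqP.
have [c [cE eE]] := E1 _ inbox0 (negbT (etrans (eq_sym _ _) (negbTE alpha_neq0))).
rewrite subr0 in eE.
have S0 : S 0 = c *: edge0 by rewrite SP cE flipZ flipA'.
have Pa : P alpha = - c *: edge1r by rewrite /P eE flipZ flip_edge1.
have : in_box (- alpha) alpha 0 by rewrite -(subrr alpha) alpha_lag ?inboxa.
move=> /E; rewrite xcorr_cornerL xcorr_cornerR // oppr0 add0r addr0 S0 eE cE Pa.
move=> /(congr1 (fun p : {poly K} => p`_0)); rewrite !coefD !coef0M !coefZ !coef0E coef0 => c8.
have c0 : c = 0.
  have : 8 * c = 0 by rewrite -[RHS]oppr0 -[in RHS]c8; ring.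
  by move/eqP; rewrite mulf_eq0 pnatr_eq0 => /eqP.
move=> y; have [yb|/S_out //] := boolP (inbox y).
have [->|y0] := eqVneq y 0; first by rewrite S0 c0 scale0r.
have [->|ya] := eqVneq y alpha; first by rewrite eE c0 oppr0 scale0r.
exact: mid.
Qed.

End Fiber.
End Corner.

(** * Limits along an ultrafilter *)

Section UltraLimits.
Context (R : realType) (U : set_system nat) (UU : UltraFilter U).
Local Notation C := R[i].

Lemma fmap_ultra (V : Type) (f : nat -> V) : UltraFilter (f @ U).
Proof.
split; first exact: fmap_proper_filter.
move=> G GF fG; rewrite predeqE => A; split; last exact: fG.
move=> GA; have [//|nA] := in_ultra_setVsetC (f @^-1` A) UU.
have GnA : G (~` A) by apply: fG.
have : G set0 by rewrite -(setICr A); exact: filterI.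
by move/filter_not_empty.
Qed.

Lemma bounded_real_ulim (f : nat -> R) (M : R) :
  (forall n, `|f n| <= M) -> exists l : R, f @ U --> l.
Proof.
move=> fM.
have := @segment_compact R (- M) M; rewrite compact_ultra => /(_ (f @ U) (fmap_ultra f)).
case=> [|l [_ fl]]; last by exists l.
apply: (@filterE _ U) => n; rewrite /= in_itv /= -ler_norml; exact: fM.
Qed.

Lemma real_ulim_unique (f : nat -> R) (x y : R) : f @ U --> x -> f @ U --> y -> x = y.
Proof. by move=> fx fy; exact: (cvg_unique (@norm_hausdorff _ _) fx fy). Qed.

Definition ulim (f : nat -> C) (l : C) : Prop :=
  (fun n => complex.Re (f n)) @ U --> complex.Re l /\
  (fun n => complex.Im (f n)) @ U --> complex.Im l.

Lemma ulim_cst c : ulim (fun=> c) c.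
Proof. by split; exact: cvg_cst. Qed.

Lemma ulimD f g l k : ulim f l -> ulim g k -> ulim (fun n => f n + g n) (l + k).
Proof.
move=> [f1 f2] [g1 g2]; split.
  by under eq_fun do rewrite complexReD; rewrite complexReD; exact: cvgD.
by under eq_fun do rewrite complexImD; rewrite complexImD; exact: cvgD.
Qed.

Lemma ulimM f g l k : ulim f l -> ulim g k -> ulim (fun n => f n * g n) (l * k).
Proof.
move=> [f1 f2] [g1 g2]; split.
  under eq_fun do rewrite complexReM; rewrite complexReM.
  by apply: cvgB; exact: cvgM.
under eq_fun do rewrite complexImM; rewrite complexImM.
by apply: cvgD; exact: cvgM.
Qed.

Lemma ulim_sum (I : Type) (r : seq I) (P : pred I) (f : I -> nat -> C) (l : I -> C) :
  (forall i, P i -> ulim (f i) (l i)) ->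
  ulim (fun n => \sum_(i <- r | P i) f i n) (\sum_(i <- r | P i) l i).
Proof.
move=> fl; elim: r => [|i r IH].
  by under eq_fun do rewrite big_nil; rewrite big_nil; exact: ulim_cst.
under eq_fun do rewrite big_cons; rewrite big_cons.
by case: ifP => // Pi; apply: ulimD => //; exact: fl.
Qed.

Lemma ulim_unique f l k : ulim f l -> ulim f k -> l = k.
Proof.
move=> [f1 f2] [k1 k2].
have := real_ulim_unique f1 k1; have := real_ulim_unique f2 k2.
by case: l k {f1 f2 k1 k2} => ? ? [? ?] /= -> // ->.
Qed.

Definition cnorm1 (z : C) : R := `|complex.Re z| + `|complex.Im z|.

Lemma bounded_ulim (f : nat -> C) M : (forall n, cnorm1 (f n) <= M) ->
  exists l, ulim f l.
Proof.
move=> fM.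
have [|x fx] := @bounded_real_ulim (fun n => complex.Re (f n)) M.
  by move=> n; apply: le_trans (fM n); rewrite lerDl.
have [|y fy] := @bounded_real_ulim (fun n => complex.Im (f n)) M.
  by move=> n; apply: le_trans (fM n); rewrite lerDr.
by exists (Complex x y).
Qed.

Lemma ulim_cnorm1 f l : ulim f l -> (fun n => cnorm1 (f n)) @ U --> cnorm1 l.
Proof. by move=> [f1 f2]; apply: cvgD; exact: cvg_norm. Qed.

Lemma cnorm1_ge0 z : 0 <= cnorm1 z. Proof. by rewrite addr_ge0. Qed.

Lemma cnorm1_eq0 z : cnorm1 z = 0 -> z = 0.
Proof.
case: z => x y /eqP; rewrite /cnorm1 /= paddr_eq0 // !normr_eq0.
by move=> /andP[/eqP -> /eqP ->].
Qed.

Lemma cnorm1_scale (s : R) z : 0 <= s -> cnorm1 (Complex s 0 * z) = s * cnorm1 z.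
Proof.
move=> s0; case: z => x y; rewrite /cnorm1 /= !mul0r subr0 addr0.
by rewrite !normrM (ger0_norm s0) mulrDr.
Qed.

Section Vectors.
Context (I : finType).
Implicit Types (u : nat -> {ffun I -> C}) (l k v : {ffun I -> C}).

Definition vulim u l : Prop := forall i, ulim (fun n => u n i) (l i).

Definition vnorm1 (v : {ffun I -> C}) : R := \sum_i cnorm1 (v i).

Lemma vnorm1_ge0 v : 0 <= vnorm1 v.
Proof. by apply: sumr_ge0 => i _; exact: cnorm1_ge0. Qed.

Lemma vnorm1_eq0 v : vnorm1 v = 0 -> v = 0.
Proof.
move=> v0; apply/ffunP => i; rewrite ffunE; apply: cnorm1_eq0; apply: le_anti.
rewrite cnorm1_ge0 andbT -v0 /vnorm1 (bigD1 i) //= lerDl.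
by apply: sumr_ge0 => j _; exact: cnorm1_ge0.
Qed.

Lemma vnorm1_0 : vnorm1 0 = 0.
Proof. by rewrite /vnorm1 big1 // => i _; rewrite ffunE /cnorm1 /= normr0 addr0. Qed.

Lemma vulim_vnorm1 u l : vulim u l -> (fun n => vnorm1 (u n)) @ U --> vnorm1 l.
Proof.
move=> ul; rewrite /vnorm1.
elim: (index_enum I) => [|i r IH].
  by under eq_fun do rewrite big_nil; rewrite big_nil; exact: cvg_cst.
under eq_fun do rewrite big_cons; rewrite big_cons.
by apply: cvgD => //; exact: ulim_cnorm1.
Qed.

Lemma bounded_vulim u M : (forall n, vnorm1 (u n) <= M) -> exists l, vulim u l.
Proof.
move=> uM.
have /choice[l ul] : forall i, exists z, ulim (fun n => u n i) z.
  move=> i; apply: (@bounded_ulim _ M) => n; apply: le_trans (uM n).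
  rewrite /vnorm1 (bigD1 i) //= lerDl.
  by apply: sumr_ge0 => j _; exact: cnorm1_ge0.
by exists [ffun i => l i] => i; rewrite ffunE.
Qed.

(** Scaled to norm one, the vectors stay bounded and cannot tend to zero. *)
Lemma normalized_vulim u : (forall n, u n != 0) ->
  exists (s : nat -> C) l, l != 0 /\ vulim (fun n => vscale (s n) (u n)) l.
Proof.
move=> u0.
have un0 n : vnorm1 (u n) != 0 by apply: contra (u0 n) => /eqP/vnorm1_eq0 ->.
pose s n : C := Complex ((vnorm1 (u n))^-1) 0.
have s1 n : vnorm1 (vscale (s n) (u n)) = 1.
  rewrite /vnorm1 (eq_bigr (fun i => (vnorm1 (u n))^-1 * cnorm1 (u n i))).
    by rewrite -mulr_sumr mulVf.
  by move=> i _; rewrite ffunE cnorm1_scale // invr_ge0 vnorm1_ge0.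
have [|l ul] := @bounded_vulim (fun n => vscale (s n) (u n)) 1; first by move=> n; rewrite s1.
exists s, l; split=> //; apply/eqP => l0.
have := vulim_vnorm1 ul; rewrite l0 vnorm1_0.
under eq_fun do rewrite s1.
have h1 : (fun _ : nat => 1 : R) @ U --> (1 : R) by exact: cvg_cst.
move=> h; have := real_ulim_unique h h1.
by move=> /esym/eqP; rewrite oner_eq0.
Qed.

(** Without a bound on [u], scale by 1 / (1 + |u_n|).  The scaling factor and the
    norm of the scaled vector add up to 1, so that their limits cannot both
    vanish. *)
Lemma projective_vulim u : exists (s : nat -> C) (c : C) l,
  [/\ ulim s c, vulim (fun n => vscale (s n) (u n)) l & c = 0 -> l != 0].
Proof.
pose r n := (1 + vnorm1 (u n))^-1.
have r0 n : 0 < r n by rewrite invr_gt0 ltr_wpDr // vnorm1_ge0.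
have rE n : r n + r n * vnorm1 (u n) = 1.
  by rewrite -[X in X + _]mulr1 -mulrDr mulVf // gt_eqF // ltr_wpDr // vnorm1_ge0.
pose s n : C := Complex (r n) 0.
have s1 n : vnorm1 (vscale (s n) (u n)) = r n * vnorm1 (u n).
  rewrite /vnorm1 mulr_sumr; apply: eq_bigr => i _.
  by rewrite ffunE cnorm1_scale // ltW.
have sn1 n : cnorm1 (s n) = r n.
  by rewrite /cnorm1 /= normr0 addr0 ger0_norm // ltW.
have [|c sc] := @bounded_ulim s 1.
  by move=> n; rewrite sn1 -[X in _ <= X](rE n) lerDl mulr_ge0 ?vnorm1_ge0 // ltW.
have [|l ul] := @bounded_vulim (fun n => vscale (s n) (u n)) 1.
  by move=> n; rewrite s1 -[X in _ <= X](rE n) lerDr ltW.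
exists s, c, l; split=> // c0; apply/eqP => l0.
have := vulim_vnorm1 ul; rewrite l0 vnorm1_0.
have := ulim_cnorm1 sc; rewrite c0 => sc0 ul0.
have : (fun n => cnorm1 (s n) + vnorm1 (vscale (s n) (u n))) @ U --> cnorm1 0 + 0 by apply: cvgD.
rewrite (_ : (fun n => _) = fun=> 1); last first.
  by apply/funext => n; rewrite s1 sn1 rE.
have h1 : (fun _ : nat => 1 : R) @ U --> (1 : R) by exact: cvg_cst.
move=> h; have := real_ulim_unique h h1.
by rewrite /cnorm1 /= normr0 !addr0 => /esym/eqP; rewrite oner_eq0.
Qed.

End Vectors.
End UltraLimits.

(** * Fiber and differential of the autocovariance map at the special point *)

Section Bilinear.
Context (K : fieldType) (d : nat) (q : Zvec d).
Local Notation coeffs := {ffun box 0 q -> K}.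
Implicit Types (a b c : coeffs).

Lemma covZl x a b t : cov (vscale x a) b t = x * cov a b t.
Proof. by rewrite /cov mulr_sumr; apply: eq_bigr => p _; rewrite ffunE mulrA. Qed.

Lemma covZr x a b t : cov a (vscale x b) t = x * cov a b t.
Proof. by rewrite /cov mulr_sumr; apply: eq_bigr => p _; rewrite ffunE mulrCA. Qed.

Lemma covBl a b c t : cov (a - b) c t = cov a c t - cov b c t.
Proof. by rewrite /cov -sumrB; apply: eq_bigr => p _; rewrite !ffunE mulrBl. Qed.

Lemma covBr a b c t : cov c (a - b) t = cov c a t - cov c b t.
Proof. by rewrite /cov -sumrB; apply: eq_bigr => p _; rewrite !ffunE mulrBr. Qed.

Lemma cov_diag_eq0 a : (forall t, cov a a t = 0) -> a = 0.
Proof.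
move=> h; apply/eqP/contraT => a0.
case/negP: (autocov_vec_neq0 (exist _ a a0)); apply/eqP/ffunP => t.
by rewrite !ffunE; exact: h.
Qed.

Lemma reverseK a : reverse (reverse a) = a.
Proof. by apply/ffunP => k; rewrite !ffunE box_revK. Qed.

Lemma reverseZ x a : reverse (vscale x a) = vscale x (reverse a).
Proof. by apply/ffunP => k; rewrite !ffunE. Qed.

End Bilinear.

Section Special.
Context (K : numFieldType) (d : nat) (q : Zvec d) (q_gt0 : forall i, 0 < q i).
Context (i0 i1 : 'I_d) (i01 : i1 != i0).
Local Notation coeffs := {ffun box 0 q -> K}.
Local Notation top := (transverse i0 q).
Local Notation m := (width q i0).

Definition special : coeffs := of_slices q i0 (@corner K d top m).

Let m_gt0 : (0 < m)%N.
Proof. by have := q_gt0 i0; rewrite /width; lia. Qed.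

Let top_ge0 i : 0 <= top i.
Proof. by rewrite transverseE; case: eqP => // _; rewrite ltW. Qed.

Let top_neq0 : top != 0.
Proof.
apply/eqP => /ffunP/(_ i1); rewrite transverseE (negbTE i01) zzeroE.
by move=> q0; have := q_gt0 i1; rewrite q0 ltxx.
Qed.

Lemma slice_special y : slice i0 special y = corner K top m y.
Proof.
have [yb|yb] := boolP (in_box 0 top y).
  by rewrite slice_of_slices // size_corner.
by rewrite slice_out // corner_out.
Qed.

Lemma lag_i0 (t : Zvec d) : in_box (- top) top t -> t i0 = 0.
Proof. by move=> /forallP/(_ i0); rewrite !zE transverseE eqxx; lia. Qed.

Lemma sliceZ x (a : coeffs) y : slice i0 (vscale x a) y = x *: slice i0 a y.
Proof.
rewrite /slice; case: ifP => _; last by rewrite scaler0.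
apply/polyP => i; rewrite coefZ !coef_poly; case: ifP; rewrite ?mulr0 // => _.
by rewrite /ext; case: insubP => [k _ _|]; rewrite ?ffunE ?mulr0.
Qed.

Lemma xcorr_slices (a b : coeffs) t : in_box (- top) top t ->
  forall j, (xcorr top (fun y => flip m (slice i0 a y)) (slice i0 b) t)`_j =
    cov a b (t + axis i0 (j%:Z - m%:Z)).
Proof. by move=> tb j; rewrite coef_xcorr // lag_i0. Qed.

Let specialE : slice i0 special = corner K top m.
Proof. by apply/funext => y; exact: slice_special. Qed.

Lemma special_fiber (b : coeffs) : (forall t, cov b b t = cov special special t) ->
  exists2 c : K, c ^+ 2 = 1 & b = vscale c special \/ b = vscale c (reverse special).
Proof.
move=> h.
have [||||||c c2 [hc|hc]] := @fiber_corner K d top m _ _ _ (slice i0 b) => //.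
- by move=> y; exact: slice_out.
- by move=> y; exact: size_slice.
- move=> t tb; rewrite -specialE; apply/polyP => j.
  by rewrite !xcorr_slices.
- exists c => //; left; apply: (slice_inj q_gt0 (i0 := i0)) => y yb.
  by rewrite sliceZ slice_special hc.
exists c => //; right; apply: (slice_inj q_gt0 (i0 := i0)) => y yb.
by rewrite sliceZ slice_reverse // slice_special hc.
Qed.

Lemma special_rigid (c : coeffs) :
  (forall t, cov special c t + cov c special t = 0) -> c = 0.
Proof.
move=> h; apply: (slice_inj q_gt0 (i0 := i0)) => y yb.
have -> : (0 : coeffs) = vscale 0 c by apply/ffunP => k; rewrite !ffunE mul0r.
rewrite sliceZ scale0r; apply: (@corner_rigid K d top m) => //.
- by move=> z; exact: slice_out.
- by move=> z; exact: size_slice.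
move=> t tb; rewrite -specialE; apply/polyP => j.
by rewrite coefD !xcorr_slices // coef0.
Qed.

(** The first pair of coefficients shows that [special] is not its own reversal,
    the second that it is not the opposite of its reversal. *)
Lemma special_asym : exists k0 k1 : box 0 q,
  [/\ special k0 = -2, special (box_rev k0) = 2, special k1 = 1 & special (box_rev k1) = 1].
Proof.
have b0 : in_box 0 q 0 by apply/forallP => i; rewrite zzeroE lexx ltW.
have bt : in_box 0 q top.
  apply/forallP => i; rewrite transverseE zzeroE.
  by case: eqP => _; rewrite ?lexx ltW.
have qt : q - top = axis i0 m%:Z.
  by apply/ffunP => i; rewrite !zE transverseE axisE widthE //;
    case: eqP => [->|_]; rewrite ?subr0 ?subrr.
have val0 y (j : nat) (k : box 0 q) : in_box 0 top y -> val k = y + axis i0 j%:Z ->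
    special k = (corner K top m y)`_j.
  by move=> yb kE; rewrite -slice_special coef_slice // -kE ext_val.
have a0 : axis i0 0 = 0 by apply/ffunP => i; rewrite axisE zzeroE; case: ifP.
have t0 : in_box 0 top 0 := inbox0 top_ge0.
have tt : in_box 0 top top := inboxa top_ge0.
have c0 : corner K top m 0 = edge0 K m by rewrite /corner eqxx.
have ct : corner K top m top = edge1 K m by rewrite /corner (negbTE top_neq0) eqxx.
exists (Sub 0 b0), (Sub top bt); split.
- by rewrite (val0 0 0%N) /= ?a0 ?addr0 // c0 coef0E.
- rewrite (val0 top m) //=; first by rewrite ct coefmE.
  by rewrite subr0 -qt addrC subrK.
- by rewrite (val0 top 0%N) /= ?a0 ?addr0 // ct coef0E.
- by rewrite (val0 0 m) //= ?qt ?add0r // c0 coefmE.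
Qed.

End Special.

(** * Deforming the special point *)

Section Good.
Context (K : fieldType) (d : nat) (q : Zvec d).
Local Notation coeffs := {ffun box 0 q -> K}.

Definition trivial_companion (a b : coeffs) : Prop :=
  [\/ b = a, b = - a, b = reverse a | b = - reverse a].

Definition determined (a : coeffs) : Prop :=
  forall b, (forall t : lag q, autocov b (val (val t)) = autocov a (val (val t))) ->
  trivial_companion a b.

Definition asymmetric (a : coeffs) : Prop := reverse a <> a /\ reverse a <> - a.

Lemma reverseN (a : coeffs) : reverse (- a) = - reverse a.
Proof. by apply/ffunP => k; rewrite !ffunE. Qed.

Lemma covNN (a b : coeffs) t : cov (- a) (- b) t = cov a b t.
Proof. by rewrite /cov; apply: eq_bigr => p _; rewrite !ffunE mulrNN. Qed.

Lemma trivial_companionN (a b : coeffs) :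
  trivial_companion a (- b) -> trivial_companion a b.
Proof.
by rewrite /trivial_companion -[in X in _ -> X](opprK b) => -[] ->; rewrite ?opprK;
  [apply: Or42|apply: Or41|apply: Or44|apply: Or43].
Qed.

Lemma trivial_companion_reverse (a b : coeffs) :
  trivial_companion a (reverse b) -> trivial_companion a b.
Proof.
by rewrite /trivial_companion -[in X in _ -> X](reverseK b) => -[] ->;
  rewrite ?reverseN ?reverseK; [apply: Or43|apply: Or44|apply: Or41|apply: Or42].
Qed.

End Good.

Section Deformation.
Context (R : realType) (d : nat) (q : Zvec d).
Local Notation C := R[i].
Local Notation coeffs := {ffun box 0 q -> C}.
Context (U : set_system nat) (UU : UltraFilter U).
Local Notation ulim := (ulim U).
Local Notation vulim := (vulim U).

Lemma ulim_cov (u v : nat -> coeffs) l k t : vulim u l -> vulim v k ->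
  ulim (fun n => cov (u n) (v n) t) (cov l k t).
Proof. by move=> ul vk; apply: ulim_sum => p _; exact: ulimM. Qed.

Section Limit.
Variables (a0 : coeffs) (a : nat -> coeffs).
Hypothesis aa0 : vulim a a0.
Hypothesis rigid : forall c, (forall t, cov a0 c t + cov c a0 t = 0) -> c = 0.

(** Since cov b b - cov a a = cov (b - a) a + cov b (b - a), the normalized
    differences of [b n] and [a n] converge to a nonzero vector killed by the
    differential at [a0]. *)
Lemma rigid_limit (b : nat -> coeffs) (s : nat -> C) (c : C) :
  (forall n t, cov (b n) (b n) t = cov (a n) (a n) t) -> ulim s c -> c != 0 ->
  vulim (fun n => vscale (s n) (b n)) (vscale c a0) -> ~ (forall n, b n <> a n).
Proof.
move=> bb sc c0 bl ba.
have [|r [l [l0 rl]]] := @normalized_vulim _ _ UU _ (fun n => b n - a n).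
  by move=> n; rewrite subr_eq0; apply/eqP.
have sa : vulim (fun n => vscale (s n) (a n)) (vscale c a0).
  by move=> k; under eq_fun do rewrite ffunE; rewrite ffunE; apply: ulimM.
case/eqP: l0; apply: rigid => t; apply: (mulfI c0); rewrite mulr0.
have h := ulimD UU (ulim_cov t bl rl) (ulim_cov t rl sa).
rewrite mulrDr -covZl -covZr; apply: (ulim_unique UU h).
rewrite (_ : (fun n => _) = fun=> 0); first exact: ulim_cst.
apply/funext => n; rewrite !(covZl, covZr) covBl covBr bb; ring.
Qed.

(** The projective limit of [b] is proportional to a trivial companion of [a0];
    after a change of sign or a reversal of all [b n], it is proportional to [a0]
    itself. *)
Lemma determined_limit (b : nat -> coeffs) :
  (forall c, (forall t, cov c c t = cov a0 a0 t) -> trivial_companion a0 c) ->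
  (forall n t, cov (b n) (b n) t = cov (a n) (a n) t) ->
  ~ (forall n, ~ trivial_companion (a n) (b n)).
Proof.
move=> fib bb bad.
have [s [c [l [sc bl cl]]]] := @projective_vulim _ _ UU _ b.
have ll t : cov l l t = c * (c * cov a0 a0 t).
  have h := ulim_cov t bl bl; apply: (ulim_unique UU h).
  rewrite (_ : (fun n => _) = fun n => s n * (s n * cov (a n) (a n) t)).
    by apply: ulimM => //; apply: ulimM => //; exact: ulim_cov.
  by apply/funext => n; rewrite covZl covZr bb.
have c0 : c != 0.
  apply/eqP => c0; have /eqP[] := cl c0; apply: cov_diag_eq0 => t.
  by rewrite ll c0 mul0r.
have vscaleK (x : coeffs) : vscale c (vscale c^-1 x) = x.
  by apply/ffunP => k; rewrite !ffunE mulVKf.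
have vscaleN (x : C) (y : coeffs) : vscale x (- y) = - vscale x y.
  by apply/ffunP => k; rewrite !ffunE mulrN.
have limN u (x : coeffs) : vulim u x -> vulim (fun n => - u n) (- x).
  move=> ux k; rewrite ffunE -mulN1r.
  rewrite (_ : (fun n => _) = fun n => -1 * u n k); last first.
    by apply/funext => n; rewrite ffunE mulN1r.
  by apply: ulimM => //; exact: ulim_cst.
have limR u (x : coeffs) : vulim u x -> vulim (fun n => reverse (u n)) (reverse x).
  by move=> ux k; rewrite ffunE; under eq_fun do rewrite ffunE; exact: ux.
have vulim_eq (u v : nat -> coeffs) (x y : coeffs) :
    u =1 v -> x = y -> vulim u x -> vulim v y by move=> /funext -> ->.
have cE : trivial_companion a0 (vscale c^-1 l).
  by apply: fib => t; rewrite covZl covZr ll !mulKf.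
rewrite -(vscaleK l) in bl.
case: cE => lE; rewrite lE in bl.
- apply: (rigid_limit bb sc c0 bl) => n bn; apply: (bad n).
  by rewrite bn; apply: Or41.
- have bl' : vulim (fun n => vscale (s n) (- b n)) (vscale c a0).
    apply: vulim_eq (limN _ _ bl) => [n|]; first by rewrite vscaleN.
    by rewrite -vscaleN opprK.
  apply: (rigid_limit _ sc c0 bl') => [n t|n bn]; first by rewrite covNN.
  by apply: (bad n); apply: trivial_companionN; rewrite bn; apply: Or41.
- have bl' : vulim (fun n => vscale (s n) (reverse (b n))) (vscale c a0).
    apply: vulim_eq (limR _ _ bl) => [n|]; first by rewrite reverseZ.
    by rewrite -reverseZ reverseK.
  apply: (rigid_limit _ sc c0 bl') => [n t|n bn]; first by rewrite cov_reverse.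
  by apply: (bad n); apply: trivial_companion_reverse; rewrite bn; apply: Or41.
have bl' : vulim (fun n => vscale (s n) (- reverse (b n))) (vscale c a0).
  apply: vulim_eq (limN _ _ (limR _ _ bl)) => [n|]; first by rewrite reverseZ vscaleN.
  by rewrite reverseZ reverseN reverseK vscaleN opprK.
apply: (rigid_limit _ sc c0 bl') => [n t|n bn]; first by rewrite covNN cov_reverse.
apply: (bad n); apply: trivial_companion_reverse; apply: trivial_companionN.
by rewrite bn; apply: Or41.
Qed.

End Limit.
End Deformation.

(** * Goodness as a first-order formula *)

Section Formula.
Context (F : closedFieldType) (d : nat) (q : Zvec d).
Local Notation coeffs := {ffun box 0 q -> F}.
Local Notation N := #|{: box 0 q}|.
Local Notation term := (GRing.term F).

Definition coef_vec (e : seq F) : coeffs := [ffun k => e`_(enum_rank k)].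

Definition big_and (T : Type) (s : seq T) (f : T -> GRing.formula F) : GRing.formula F :=
  foldr (fun x g => GRing.And (f x) g) (GRing.Bool true) s.

Lemma holds_big_and (T : finType) (f : T -> GRing.formula F) e :
  GRing.holds e (big_and (enum T) f) <-> forall x, GRing.holds e (f x).
Proof.
have aux s : GRing.holds e (big_and s f) <-> forall x, x \in s -> GRing.holds e (f x).
  elim: s => [|x s IH] /=; first by split.
  split=> [[hx /IH hs] y|h]; first by rewrite inE => /orP[/eqP ->//|/hs].
  split; first by apply: h; rewrite inE eqxx.
  by apply/IH => y ys; apply: h; rewrite inE ys orbT.
by split=> [/aux h x|h]; [apply: h; rewrite mem_enum|apply/aux].
Qed.

Definition vec_eq_formula (u v : box 0 q -> term) : GRing.formula F :=
  big_and (enum {: box 0 q}) (fun k => GRing.Equal (u k) (v k)).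

Lemma holds_vec_eq e u v : GRing.holds e (vec_eq_formula u v) <->
  [ffun k => GRing.eval e (u k)] = [ffun k => GRing.eval e (v k)] :> coeffs.
Proof.
split=> [/holds_big_and h|/ffunP h].
  by apply/ffunP => k; rewrite !ffunE; exact: h.
by apply/holds_big_and => k /=; have := h k; rewrite !ffunE.
Qed.

Definition autocov_term (u : box 0 q -> term) (t : Zvec d) : term :=
  \big[@GRing.Add F/GRing.Const 0]_(p : box 0 q * box 0 q | val p.2 == val p.1 + t)
    GRing.Mul (u p.1) (u p.2).

Lemma eval_autocov_term e u t :
  GRing.eval e (autocov_term u t) = autocov [ffun k => GRing.eval e (u k)] t.
Proof.
rewrite /autocov_term (big_morph (GRing.eval e) (id1 := 0) (op1 := +%R)) //.
by apply: eq_bigr => p _; rewrite !ffunE.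
Qed.

(** The coordinates of [a] are the free variables 0, ..., N - 1, and those of [b]
    the bound variables N, ..., 2 N - 1. *)
Definition var_a (k : box 0 q) : term := GRing.Var F (enum_rank k).
Definition var_b (k : box 0 q) : term := GRing.Var F (N + enum_rank k).

Definition companion_formula : GRing.formula F :=
  GRing.Implies
    (big_and (enum {: lag q}) (fun t =>
       GRing.Equal (autocov_term var_b (val (val t))) (autocov_term var_a (val (val t)))))
    (GRing.Or (vec_eq_formula var_b var_a)
    (GRing.Or (vec_eq_formula var_b (fun k => GRing.Opp (var_a k)))
    (GRing.Or (vec_eq_formula var_b (fun k => var_a (box_rev k)))
      (vec_eq_formula var_b (fun k => GRing.Opp (var_a (box_rev k))))))).

Definition good_formula : GRing.formula F :=
  GRing.And (GRing.Not (vec_eq_formula (fun k => var_a (box_rev k)) var_a))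
  (GRing.And (GRing.Not
     (vec_eq_formula (fun k => var_a (box_rev k)) (fun k => GRing.Opp (var_a k))))
   (foldr GRing.Forall companion_formula (iota N N))).

Lemma eval_rev e : [ffun k => GRing.eval e (var_a (box_rev k))] = reverse (coef_vec e).
Proof. by apply/ffunP => k; rewrite !ffunE. Qed.

Lemma eval_opp e : [ffun k => GRing.eval e (GRing.Opp (var_a k))] = - coef_vec e.
Proof. by apply/ffunP => k; rewrite !ffunE. Qed.

Lemma eval_oppr e :
  [ffun k => GRing.eval e (GRing.Opp (var_a (box_rev k)))] = - reverse (coef_vec e).
Proof. by apply/ffunP => k; rewrite !ffunE. Qed.

Lemma holds_companion e : GRing.holds e companion_formula <->
  let b := [ffun k => GRing.eval e (var_b k)] in
  (forall t : lag q, autocov b (val (val t)) = autocov (coef_vec e) (val (val t))) ->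
  trivial_companion (coef_vec e) b.
Proof.
rewrite /=; split=> h hc.
  have [|/holds_vec_eq H|[/holds_vec_eq|[/holds_vec_eq|/holds_vec_eq]]] := h.
  - by apply/holds_big_and => t /=; rewrite !eval_autocov_term; exact: hc.
  - exact: Or41.
  - by rewrite eval_opp; exact: Or42.
  - by rewrite eval_rev; exact: Or43.
  - by rewrite eval_oppr; exact: Or44.
have [||||] := h.
- by move=> t; have /holds_big_and/(_ t)/= := hc; rewrite !eval_autocov_term.
- by move=> E; left; apply/holds_vec_eq.
- by move=> E; right; left; apply/holds_vec_eq; rewrite eval_opp.
- by move=> E; right; right; left; apply/holds_vec_eq; rewrite eval_rev.
- by move=> E; right; right; right; apply/holds_vec_eq; rewrite eval_oppr.
Qed.

Lemma holds_good e : size e = N ->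
  GRing.holds e good_formula <-> asymmetric (coef_vec e) /\ determined (coef_vec e).
Proof.
move=> se; rewrite /good_formula /asymmetric /=.
rewrite !holds_vec_eq eval_rev eval_opp -GRing.foldForallP.
have -> : [ffun k => GRing.eval e (var_a k)] = coef_vec e by [].
split=> [[h1 [h2 h3]]|[[h1 h2] h3]]; split=> //.
  move=> b bh.
  pose e' := e ++ codom b.
  have va : coef_vec e' = coef_vec e.
    by apply/ffunP => k; rewrite !ffunE nth_cat se ltn_ord.
  have vb : [ffun k => GRing.eval e' (var_b k)] = b.
    by apply/ffunP => k; rewrite !ffunE /= nth_cat se ltnNge leq_addr /= addKn nth_codom enum_rankK.
  have /holds_companion : GRing.holds e' companion_formula.
    apply: h3 => i; rewrite inE /= mem_iota => iN.
    rewrite nth_cat se; case: ltnP => // Ni.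
    rewrite !nth_default ?se // size_codom leq_subRL //.
    by move: iN; rewrite Ni /= -leqNgt.
  by rewrite /= vb va; apply.
split=> // e' ee'; apply/holds_companion => /=.
have -> : coef_vec e' = coef_vec e.
  apply/ffunP => k; rewrite !ffunE ee' // inE /= mem_iota negb_and -ltnNge.
  by rewrite ltn_ord.
exact: h3.
Qed.

End Formula.

(** * Generic points and projective fibers *)

Section Generic.
Context (R : realType) (d : nat) (q : Zvec d) (q_gt0 : forall i, 0 < q i).
Context (i0 i1 : 'I_d) (i01 : i1 != i0).
Local Notation C := R[i].
Local Notation coeffs := {ffun box 0 q -> C}.
Local Notation N := #|{: box 0 q}|.
Local Notation special := (special C q i0).

(** Moving the coordinates only by nonnegative reals of size at most 1 keeps
    enough freedom to avoid the zeros of a polynomial, and makes asymmetry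
    visible on real parts. *)
Definition close (n : nat) (a : coeffs) : Prop :=
  forall k, exists2 r : R, 0 <= r <= harmonic n & a k = special k + Complex r 0.

Lemma close_asymmetric n a : close n a -> asymmetric a.
Proof.
move=> an.
have r1 (r : R) : 0 <= r <= harmonic n -> 0 <= r <= 1.
  move=> /andP[-> /= rn]; apply: le_trans rn _.
  by rewrite /harmonic invf_le1 ?ltr0n // ler1n.
have [k0 [k1 [h1 h2 h3 h4]]] := special_asym C q_gt0 i01.
split=> /ffunP E.
  have := E k0; rewrite ffunE; have [r /r1 rn ->] := an k0.
  have [r' /r1 rn' ->] := an (box_rev k0); rewrite h1 h2.
  by move=> /(congr1 (@complex.Re R)) /=; lra.
have := E k1; rewrite !ffunE; have [r /r1 rn ->] := an k1.
have [r' /r1 rn' ->] := an (box_rev k1); rewrite h3 h4.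
by move=> /(congr1 (@complex.Re R)) /=; lra.
Qed.

Lemma close_dense n (p : ipoly C N) : p != 0 ->
  exists e, [/\ size e = N, ieval N e p != 0 & close n (coef_vec q e)].
Proof.
move=> p0.
pose S i (x : C) := exists2 r : R, 0 <= r <= harmonic n & x = (codom special)`_i + Complex r 0.
have [|e [se pe eS]] := @nonroot_box _ N p S _ p0.
  move=> i k; pose f j := (codom special)`_i + Complex (harmonic (n + j) : R) 0.
  exists [seq f j | j <- iota 0 k]; split.
  - rewrite map_inj_uniq ?iota_uniq // => j j' /addrI [] /invr_inj/eqP.
    by rewrite eqr_nat eqSS eqn_add2l => /eqP.
  - by rewrite size_map size_iota.
  move=> x /mapP[j _ ->]; exists (harmonic (n + j)) => //.
  rewrite /harmonic invr_ge0 ler0n /= lef_pV2 ?posrE ?ltr0n //.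
  by rewrite ler_nat ltnS leq_addr.
exists e; split=> // k; have [r rn ekE] := eS (enum_rank k) (ltn_ord _).
by exists r => //; rewrite ffunE ekE nth_codom enum_rankK.
Qed.

Lemma close_vulim (U : set_system nat) (UU : UltraFilter U) (a : nat -> coeffs) :
  \oo `<=` U -> (forall n, close n (a n)) -> vulim U a special.
Proof.
move=> ooU an k.
have oocvg (f : nat -> R) (l : R) : f @ \oo --> l -> f @ U --> l.
  by move=> fl A /fl; exact: ooU.
split; apply: oocvg.
  have h : (fun n => complex.Re (special k) + harmonic n) @ \oo --> complex.Re (special k).
    rewrite -[X in _ --> X]addr0; apply: cvgD; [exact: cvg_cst|exact: cvg_harmonic].
  apply: (squeeze_cvgr _ (cvg_cst _) h); near=> n.
  have [r /andP[r0 rn] ->] := an n k.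
  case: (special k) => x y /=; rewrite lerDl r0 /=.
  by rewrite lerD2l.
rewrite (_ : (fun n => _) = fun=> complex.Im (special k)); first exact: cvg_cst.
apply/funext => n; have [r _ ->] := an n k.
by case: (special k) => x y /=; rewrite addr0.
Unshelve. all: by end_near. Qed.

(** The alternative in [definable_generic] that almost nothing is good is excluded
    by a sequence of bad points tending to the special one. *)
Lemma generic_good : exists2 p : ipoly C N, p != 0 &
  forall e, size e = N -> ieval N e p != 0 ->
    asymmetric (coef_vec q e) /\ determined (coef_vec q e).
Proof.
have [p p0 [good|bad]] := @definable_generic C N (good_formula C q); exists p => //.
  by move=> e se pe; apply: (proj1 (@holds_good C d q e se)); exact: good.
exfalso.
have [U [UU ooU]] := ultraFilterLemma (_ : ProperFilter \oo).
have /choice[e eP] n := @close_dense n p p0.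
have /choice[b bP] n : exists b,
    (forall t, cov b b t = cov (coef_vec q (e n)) (coef_vec q (e n)) t) /\
    ~ trivial_companion (coef_vec q (e n)) b.
  have [se pe en] := eP n.
  apply: contrapT => nob; apply: (bad _ se pe); apply: (proj2 (@holds_good C d q _ se)).
  split; first exact: close_asymmetric en.
  move=> b hb; apply: contrapT => ntb; apply: nob; exists b; split=> //.
  exact: autocov_lags.
apply: (@determined_limit _ _ _ U UU special (fun n => coef_vec q (e n)) _ _ b).
- by apply: close_vulim => // n; have [] := eP n.
- by move=> c; exact: (special_rigid q_gt0 i01).
- move=> c hc; have [s s2 cE] := special_fiber q_gt0 i01 hc.
  have vs1 (x : coeffs) : vscale 1 x = x by apply/ffunP => k; rewrite ffunE mul1r.
  have vsN1 (x : coeffs) : vscale (-1) x = - x by apply/ffunP => k; rewrite !ffunE mulN1r.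
  move/eqP: s2; rewrite sqrf_eq1 => /orP[] /eqP sE; rewrite sE ?vs1 ?vsN1 in cE.
    by case: cE => ->; [apply: Or41|apply: Or43].
  by case: cE => ->; [apply: Or42|apply: Or44].
- by move=> n; have [] := bP n.
by move=> n; have [] := bP n.
Qed.

End Generic.

Section Fibers.
Context (F : numClosedFieldType) (d : nat) (q : Zvec d).
Local Notation pt := (@proj_pt F (box 0 q)).

Lemma autocov_cov (a : {ffun box 0 q -> F}) t : autocov a t = cov a a t.
Proof. by []. Qed.

(** If the autocovariances of [a] are [c] times those of [b], then [sqrtC c]
    times [b] has the same autocovariances as [a]. *)
Lemma determined_fiber (a : nonzero F (box 0 q)) :
  asymmetric (val a) -> determined (val a) ->
  @Gamma F d q @^-1` [set Gamma (pt a)] = [set pt a; pt (reverse_nz a)] /\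
  pt a <> pt (reverse_nz a).
Proof.
move=> [as1 as2] det; split; last first.
  move=> /proj_eqP/asboolP[c c0 E].
  have c2 : c ^+ 2 = 1.
    have [k ak] : exists k, val a k != 0.
      apply: contrapT => h; case/negP: (valP a); apply/eqP/ffunP => k.
      by rewrite ffunE; apply/eqP/contraT => ak; case: h; exists k.
    apply/eqP; rewrite -subr_eq0 -(mulIr_eq0 _ (mulIf ak)) mulrBl mul1r subr_eq0.
    have := E k; have := E (box_rev k); rewrite /= !ffunE box_revK => e1 e2.
    by rewrite [X in _ == X]e1 e2 mulrA expr2.
  move/eqP: c2; rewrite sqrf_eq1 => /orP[] /eqP cE; [apply: as1|apply: as2];
    by apply/ffunP => k; have := E k; rewrite cE /= ?ffunE ?mul1r ?mulN1r.
have rev_fiber : Gamma (pt (reverse_nz a)) = Gamma (pt a).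
  rewrite !Gamma_pt; congr proj_pt; apply/val_inj/ffunP => t.
  by rewrite !ffunE; exact: cov_reverse.
apply/seteqP; split => [x|x [->|->]] //=.
rewrite -[x]reprK; set b := repr x; rewrite -/(pt b) !Gamma_pt.
move=> /proj_eqP/asboolP[c c0 E].
pose s := sqrtC c.
have s0 : s != 0 by rewrite sqrtC_eq0.
have [] := det (vscale s (val b)).
- move=> t; have := E t; rewrite /= !ffunE => ->.
  by rewrite !autocov_cov covZl covZr mulrA -expr2 sqrtCK.
- move=> sb; left; apply/esym/proj_eqP/asboolP; exists s^-1; rewrite ?invr_eq0 // => k.
  by rewrite -sb ffunE mulKf.
- move=> sb; left; apply/esym/proj_eqP/asboolP; exists (- s^-1);
    rewrite ?oppr_eq0 ?invr_eq0 // => k.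
  by rewrite mulNr -mulrN -[in RHS](opprK (val a)) -sb !ffunE opprK mulKf.
- move=> sb; right; apply/esym/proj_eqP/asboolP; exists s^-1; rewrite ?invr_eq0 // => k.
  by rewrite /= -sb ffunE mulKf.
move=> sb; right; apply/esym/proj_eqP/asboolP; exists (- s^-1);
    rewrite ?oppr_eq0 ?invr_eq0 // => k.
by rewrite mulNr -mulrN /= -[in RHS](opprK (reverse _)) -sb !ffunE opprK mulKf.
Qed.

End Fibers.

Unset Implicit Arguments.
Set Strict Implicit.

Theorem theorem4p4 (R : realType) (d : nat) (d_gt1 : (1 < d)%N)
    (q : Zvec d) (q_gt0 : forall i, 0 < q i) :
  almost_all (fun a : {ffun box 0 q -> R[i]} =>
    exists a0 : nonzero R[i] (box 0 q), val a0 = a /\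
      let p := proj_pt a0 in
      let p' := proj_pt (reverse_nz a0) in
      let gamma := Gamma p in
      @Gamma R[i] d q @^-1` [set gamma] = [set p; p'] /\ p <> p').
Proof.
pose i0 : 'I_d := Ordinal (ltnW d_gt1); pose i1 : 'I_d := Ordinal d_gt1.
have i01 : i1 != i0 by [].
have [p p0 hp] := generic_good R q_gt0 i01.
rewrite /almost_all; apply: negligibleS (zeros_null p0) => v /=.
apply: contra_notP => /eqP pv.
have ve : coef_vec q [seq to_complex z | z <- v] = coefs v.
  apply/ffunP => k; rewrite !ffunE (nth_map (0, 0)) ?size_tuple //.
  by rewrite -tnth_nth.
have [|as_v det_v] := hp _ _ pv; first by rewrite size_map size_tuple.
rewrite ve in as_v det_v.
have a0 : coefs v != 0.
  by apply/eqP => v0; case: as_v => + _; apply; apply/ffunP => k; rewrite v0 !ffunE.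
pose an : nonzero R[i] (box 0 q) :=
  exist (fun a : {ffun box 0 q -> R[i]} => is_true (a != 0)) (coefs v) a0.
by exists an; split=> //; exact: (@determined_fiber R[i] d q an as_v det_v).
Qed.
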